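(* Let $X$ be a real Hilbert space, $T>0$, $u_0\in X$, and let $\mathcal{F}:(0,T]\times X\to X$ be a possibly nonlinear operator such that, for all $t\in(0,T]$, $$\langle \mathcal{F}(t,v),v\rangle_X=0\quad\forall v\in X,\qquad\text{and}\qquad \langle \mathcal{F}(t,v),w\rangle_X\ge-\langle v,\mathcal{F}(t,w)\rangle_X\quad\forall v,w\in X.$$ Let $u:[0,T]\to X$ be an exact solution of the initial value problem $$\dot u(t)=\mathcal{F}(t,u(t)),\quad t\in(0,T],\qquad u(0)=u_0,$$ with $\dot u\in L^1((0,T);X)$. Let $0=t_0<t_1<\dots<t_M=T$ be a time partition with time steps $I_m=(t_{m-1},t_m)$, let $\bm r=\{r_m\}_{m=1}^M$ be polynomial degrees with $r_m\ge1$, and let $U\in C^0([0,T];X)$ with $U|_{I_m}\in\mathbb{P}^{r_m}(I_m;X)$ for $m=1,\dots,M$ be a solution of the continuous Galerkin scheme, i.e., $U(0)=u_0$ and $$\int_{I_m}\langle \dot U(t)-\mathcal{F}(t,(\Pi^{r_m-1}U)(t)),V(t)\rangle_X\,\mathrm{d}t=0\qquad\forall V\in\mathbb{P}^{r_m-1}(I_m;X),\quad m=1,\dots,M.$$ Let $\widehat U:[0,T]\to X$ be the reconstruction of $U$ given in the context. Then, for any $t\in[0,T]$, $$\|u-U\|_{L^\infty((0,t);X)}\le\|\mathcal{F}(\widehat U)-\dot{\widehat U}\|_{L^1((0,t);X)}+\|U-\widehat U\|_{L^\infty((0,t);X)},$$ where $\mathcal{F}(\widehat U)$ denotes the function $\tau\mapsto\mathcal{F}(\tau,\widehat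 U(\tau))$.
   Context: $\langle\cdot,\cdot\rangle_X$ and $\|\cdot\|_X$ are the inner product and induced norm of $X$. For an interval $I$ and $r\in\mathbb{N}_0$, $\mathbb{P}^r(I;X)$ is the space of polynomials $p(t)=\sum_{i=0}^r x_it^i$ on $\overline I$ with coefficients $x_i\in X$. $L^p(I;X)$ are the usual Bochner spaces with norms $\|\cdot\|_{L^p(I;X)}$. The condition $\dot u\in L^1((0,T);X)$ is understood in the sense that it implies $u\in C^0([0,T];X)$ (so $u$ is the integral of $\dot u$). For $r\in\mathbb{N}_0$, $\Pi^{r}:L^2(I_m;X)\to\mathbb{P}^{r}(I_m;X)$ is the $L^2$-projection on $I_m$, defined by $\int_{I_m}\langle W-\Pi^{r}W,V\rangle_X\,\mathrm{d}t=0$ for all $V\in\mathbb{P}^{r}(I_m;X)$ (used for $r=r_m-1$ and $r=r_m$). For a function $W$ with values in $X$, $\mathcal{F}(W)$ denotes $t\mapsto\mathcal{F}(t,W(t))$. Reconstruction: write $U^{m}:=U(t_{m})$. For $m=1,\dots,M$, let $\mathcal{L}^m\in\mathbb{P}^{r_m}(I_m;\mathbb{R})$ be the real polynomial determined by $$\int_{I_m}\mathcal{L}^m(t)q(t)\,\mathrm{d}t=q(t_{m-1})\qquad\forall q\in\mathbb{P}^{r_m}(I_m;\mathbb{R}),$$ and let $$\mathfrak{U}^{m-1}:=\int_{I_m}\Pi^{r_m-1}\big(\mathcal{F}(\Pi^{r_m-1}U)-\mathcal{F}(U)\big)\,\mathrm{d}t=U^m-U^{m-1}-\int_{I_m}\Pi^{r_m}\mathcal{F}(U)\,\mathrm{d}t\in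 X.$$ Then $\widehat U$ is defined on each $\overline I_m$ by $$\widehat U(t):=U^{m-1}+\int_{t_{m-1}}^t\Pi^{r_m}\mathcal{F}(U)\,\mathrm{d}\tau+\mathfrak{U}^{m-1}\int_{t_{m-1}}^t\mathcal{L}^m(\tau)\,\mathrm{d}\tau,\qquad t\in\overline I_m;$$ it satisfies $\widehat U(t_{m-1})=U^{m-1}$, $\widehat U(t_m)=U^m$, so it is well defined and continuous on $[0,T]$. $\dot{\widehat U}$ is its piecewise time derivative. It is understood that $\mathcal{F}(\Pi^{r_m-1}U)$ and $\mathcal{F}(U)$ belong to $L^2(I_m;X)$ for each $m$, and that $\mathcal{F}(\widehat U)$ is measurable on $(0,T)$ (the $L^1$-norm on the right-hand side being $+\infty$ if it is not finite). *)

(* Defs.v *)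
From HB Require Import structures.
From mathcomp Require Import all_boot all_order all_algebra.
From mathcomp Require Import sesquilinear.
From mathcomp Require Import all_classical all_reals all_analysis.

Set Implicit Arguments.
Unset Strict Implicit.
Unset Printing Implicit Defensive.

Import Order.TTheory GRing.Theory Num.Theory.
Import numFieldNormedType.Exports.

Local Open Scope classical_set_scope.
Local Open Scope ring_scope.

(** A real Hilbert space is a complete normed space [X] whose norm comes from
    the positive definite symmetric form [ip].  Functions on an interval are
    represented by functions on the whole of [R]; only their values on that
    interval are ever used. *)
Definition hilbert_norm (R : realType) (X : completeNormedModType R)
    (ip : {dot X for (@idfun R)}) : Prop :=
  forall x : X, `|x| ^+ 2 = ip x x.

Section Bochner.
Context {R : realType} {X : completeNormedModType R}.
Implicit Types (D : set R) (f : R -> X) (p : \bar R).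

Local Notation mu := (@lebesgue_measure R).

Definition simple_fun (s : R -> X) : Prop :=
  finite_set (range s) /\
  forall x : X, measurable (s @^-1` [set x] : set (measurableTypeR R)).

(** Meant for [D] of finite measure, where no value of [mu] is infinite. *)
Definition simple_integral D (s : R -> X) : X :=
  \sum_(x \in range s) fine (mu (D `&` s @^-1` [set x])) *: x.

(** Limits are only required almost everywhere: although the simple functions
    are Borel, this is strong measurability for the completed (Lebesgue)
    sigma-algebra. *)
Definition simple_approx D f (s : nat -> R -> X) : Prop :=
  (forall n, simple_fun (s n)) /\
  {ae mu, forall t, D t -> s n t @[n --> \oo] --> f t}.

Definition strongly_measurable D f : Prop := exists s, simple_approx D f s.

Definition is_bochner_integral D f (x : X) : Prop :=
  exists s : nat -> R -> X,
    [/\ simple_approx D f s,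
        (\int[mu]_(t in D) `|f t - s n t|%:E)%E @[n --> \oo] --> 0%E &
        simple_integral D (s n) @[n --> \oo] --> x].

Definition bochner_integral D f : X := xget 0 (is_bochner_integral D f).

(** The [L^p] norm on [D] is that of the extension by zero; in particular it
    vanishes when [D] is empty. *)
Definition LpX_norm p D f : \bar R :=
  Lnorm mu p ((fun t => `|f t|%:E) \_ D).

Definition LpX p D f : Prop :=
  strongly_measurable D f /\ (LpX_norm p D f < +oo)%E.

Definition Xpoly (r : nat) (P : R -> X) : Prop :=
  exists c : 'I_r.+1 -> X, forall t, P t = \sum_(i < r.+1) t ^+ i *: c i.

(** [du] is the time derivative, in [L^1((0,T);X)], of the absolutely
    continuous function [u] on [[0,T]]. *)
Definition is_time_derivative (T : R) (u du : R -> X) : Prop :=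
  LpX 1%E `]0, T[ du /\
  forall t, 0 <= t <= T -> u t = u 0 + bochner_integral `]0, t[ du.

End Bochner.

(** The superposition operator, [F(W) : t |-> F(t, W t)]. *)
Definition superpos (R X : Type) (F : R -> X -> X) (W : R -> X) : R -> X :=
  fun t => F t (W t).

Section Galerkin.
Context {R : realType} {X : completeNormedModType R}.
Variable ip : {dot X for (@idfun R)}.

Local Notation mu := (@lebesgue_measure R).

Definition is_L2proj (r : nat) (a b : R) (W P : R -> X) : Prop :=
  Xpoly r P /\
  forall V : R -> X, Xpoly r V ->
    \int[mu]_(t in `]a, b[) ip (W t - P t) (V t) = 0.

(** For [a < b] and [W] in [L^2((a,b);X)] there is exactly one such polynomial
    function on [R]. *)
Definition L2proj (r : nat) (a b : R) (W : R -> X) : R -> X :=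
  xget (fun=> 0) (is_L2proj r a b W).

(** The real polynomial of degree at most [r] that represents evaluation
    at [a] on the polynomials of degree at most [r] on [(a,b)]. *)
Definition lift_poly (r : nat) (a b : R) : {poly R} :=
  xget 0 [set L : {poly R} | (size L <= r.+1)%N /\
    forall q : {poly R}, (size q <= r.+1)%N ->
      \int[mu]_(t in `]a, b[) (L.[t] * q.[t]) = q.[a]].

Definition exact_solution (F : R -> X -> X) (T : R) (u0 : X) (u : R -> X) :
    Prop :=
  u 0 = u0 /\
  exists2 du : R -> X, is_time_derivative T u du &
    forall t, 0 < t <= T -> du t = F t (u t).

(** Nodes [tn 0 < ... < tn M]; the [m]-th interval, [1 <= m <= M], is
    [(tn m.-1, tn m)] and carries the degree [r m]. *)
Definition is_partition (T : R) (M : nat) (tn : nat -> R) : Prop :=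
  [/\ tn 0%N = 0, tn M = T & forall m, (m < M)%N -> tn m < tn m.+1].

Definition cG_solution (F : R -> X -> X) (T : R) (u0 : X)
    (M : nat) (tn : nat -> R) (r : nat -> nat) (U : R -> X) : Prop :=
  [/\ {within `[0, T], continuous U},
      (forall m, (1 <= m <= M)%N ->
         exists2 P, Xpoly (r m) P &
           forall t, tn m.-1 <= t <= tn m -> U t = P t),
      U 0 = u0 &
      forall m, (1 <= m <= M)%N ->
      forall V : R -> X, Xpoly (r m).-1 V ->
        \int[mu]_(t in `]tn m.-1, tn m[)
          ip (derive1 U t -
              superpos F (L2proj (r m).-1 (tn m.-1) (tn m) U) t) (V t) = 0].

Section Reconstruction.
Variables (F : R -> X -> X) (M : nat) (tn : nat -> R) (r : nat -> nat).
Variable U : R -> X.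

Definition recon_defect (m : nat) : X :=
  let Pi := L2proj (r m).-1 (tn m.-1) (tn m) in
  bochner_integral `]tn m.-1, tn m[
    (Pi (fun t => superpos F (Pi U) t - superpos F U t)).

Definition recon_piece (m : nat) (t : R) : X :=
  U (tn m.-1)
  + bochner_integral `]tn m.-1, t[
      (L2proj (r m) (tn m.-1) (tn m) (superpos F U))
  + (\int[mu]_(s in `]tn m.-1, t[) (lift_poly (r m) (tn m.-1) (tn m)).[s])
      *: recon_defect m.

(** Two pieces agree at a common node, so the choice made by [pick] there is
    immaterial.  The value outside [[tn 0, tn M]] is irrelevant. *)
Definition reconstruction (t : R) : X :=
  if [pick m : 'I_M | tn m <= t <= tn m.+1] is Some m
  then recon_piece m.+1 t else 0.

End Reconstruction.
End Galerkin.

(* Main.v *)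
Require Import Defs.
From HB Require Import structures.
From mathcomp Require Import all_boot all_order all_algebra.
From mathcomp Require Import sesquilinear.
From mathcomp Require Import all_classical all_reals all_analysis.
From mathcomp Require Import measurable_realfun ess_sup_inf.
From mathcomp Require Import ring lra.

Set Implicit Arguments.
Unset Strict Implicit.
Unset Printing Implicit Defensive.

Import Order.TTheory GRing.Theory Num.Theory.
Import numFieldNormedType.Exports.

Local Open Scope classical_set_scope.
Local Open Scope ring_scope.


(** The reconstruction is a continuous, piecewise polynomial function with
    [Uh (tn m) = U (tn m)] at every node: on the [m]-th step its increment is
    the integral of the projection of [F U] plus the defect, and the Galerkin
    equation tested against constants says that this sum is the increment of
    [U] ([recon_piece_right]).  Hence [e := u - Uh] is absolutely continuous
    with [e 0 = 0], and almost everywhere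
    [e' = F u - F Uh + rho], where [rho := F Uh - Uh'] is the residual.  The
    two assumptions on [F] give [<F u - F Uh, u - Uh> <= 0], so that
    [<e, e'> <= |e| |rho|] ([dissipative]).  Formally [|e|' <= |rho|], so
    [|u s - Uh s|] is at most the integral of [|rho|] over [(0, s)], and the
    triangle inequality finishes the proof.

    The step from [<e, e'> <= |e| |rho|] to a bound of [|e|] ([norm_growth])
    avoids differentiating [|e|].  The function
    [phi x = sqrt (eps ^ 2 + |x| ^ 2)] is convex with Lipschitz gradient
    [x / phi x]; hence
    [phi (e s') - phi (e s) <= <e s' / phi (e s'), e s' - e s>], and the right
    side is the integral of [<e s' / phi (e s'), e'>] over [(s, s')].  Since
    [e] is uniformly continuous, [e s' / phi (e s')] may be replaced by
    [e t / phi (e t)] under the integral up to [eps] when [s' - s] is small,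
    and there the integrand is at most [|rho|].  Summing over short intervals
    and letting [eps] tend to [0] gives the claim.

    All vector-valued integrals are used through their inner products with
    fixed vectors: [bochner_integral_ip] states
    [<x, int f> = int <x, f>] for every [f] in [L^1].  Its proof contains the
    existence of the integral, because simple integrals satisfy the same
    identity, and this makes them a Cauchy sequence.  The functions involved
    are only Lebesgue measurable, while the real integral is taken over the
    Borel sigma-algebra; each of them is therefore replaced by a Borel
    representative ([L1_rep]) that coincides with it off a Borel null set,
    which changes no integral ([integral_off_null]).  The residual gets its
    representative step by step; on the whole interval the integral of its
    norm is only used as a superadditive function of the domain
    ([ge0_integral_superadd]).

    Both the projections and the lifting polynomial are defined by a choice
    that is meaningful only if a solution of their defining equations exists.
    In the monomial basis these equations are linear systems with the same
    Gram matrix, which is invertible ([gram_unit]). *)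

(** * Integrals of arbitrary functions *)

Section NullSets.
Import HBNNSimple.
Context d (T : measurableType d) (R : realType).
Variable mu : {measure set T -> \bar R}.
Local Open Scope ereal_scope.

Let ge0_le_integral_off_null (N : set T) (f g : T -> \bar R) :
  measurable N -> mu N = 0 -> (forall t, 0 <= f t) -> (forall t, 0 <= g t) ->
  (forall t, ~ N t -> f t = g t) ->
  \int[mu]_t f t <= \int[mu]_t g t.
Proof.
move=> mN N0 f0 g0 fg; rewrite !ge0_integralTE//.
apply: ge_ereal_sup => _ [h hf <-].
pose k := mul_nnsfun h (indic_nnsfun R (measurableC mN)).
apply: le_trans (ereal_sup_ubound _); last first.
  exists k; last reflexivity; move=> t /=.
  rewrite mindicE; case: (boolP (t \in ~` N)) => [|_]; last by rewrite mulr0.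
  by rewrite inE => Nt; rewrite mulr1 -fg.
rewrite -!integralT_nnsfun le_eqVlt; apply/orP; left; apply/eqP.
apply: ge0_ae_eq_integral => //.
- exact/measurable_EFinP.
- exact/measurable_EFinP.
- by move=> t _; rewrite lee_fin.
- by move=> t _; rewrite lee_fin.
exists N; split => // t /= /not_implyP[_]; apply: contra_notP => Nt.
by rewrite /= mindicE mem_set// mulr1.
Qed.

Let ge0_integral_off_null (N : set T) (f g : T -> \bar R) :
  measurable N -> mu N = 0 -> (forall t, 0 <= f t) -> (forall t, 0 <= g t) ->
  (forall t, ~ N t -> f t = g t) ->
  \int[mu]_t f t = \int[mu]_t g t.
Proof.
move=> mN N0 f0 g0 fg; apply/eqP; rewrite eq_le.
by apply/andP; split; apply: (@ge0_le_integral_off_null N) => // t /fg.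
Qed.

(** The integral of any nonnegative function is a supremum over simple
    minorants, and cutting these off on a null set keeps their integrals.  So
    a Borel function may replace a function that is only Lebesgue measurable. *)
Lemma integral_off_null (D N : set T) (f g : T -> \bar R) :
  measurable N -> mu N = 0 -> (forall t, D t -> ~ N t -> f t = g t) ->
  \int[mu]_(t in D) f t = \int[mu]_(t in D) g t.
Proof.
move=> mN N0 fg; rewrite integral_mkcond [RHS]integral_mkcond.
rewrite integralE [RHS]integralE.
have fgD t : ~ N t -> (f \_ D) t = (g \_ D) t.
  by move=> Nt; rewrite !patchE; case: ifPn => //; rewrite inE => /fg ->.
congr (_ - _); apply: (@ge0_integral_off_null N) => // t Nt.
  by rewrite !funeposE fgD.
by rewrite !funenegE fgD.
Qed.

Lemma Rintegral_off_null (D N : set T) (f g : T -> R) :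
  measurable N -> mu N = 0 -> (forall t, D t -> ~ N t -> f t = g t) ->
  (\int[mu]_(t in D) f t)%R = (\int[mu]_(t in D) g t)%R.
Proof.
move=> mN N0 fg; congr fine; apply: (@integral_off_null D N) => //.
by move=> t Dt Nt; rewrite fg.
Qed.

End NullSets.


Section Superadditivity.
Import HBNNSimple.
Context d (T : measurableType d) (R : realType).
Variable mu : {measure set T -> \bar R}.
Local Open Scope ereal_scope.

(** Simple minorants on [A] and on [B] add up to a minorant on the union. *)
Lemma ge0_integral_superadd (A B : set T) (f : T -> \bar R) :
  (forall t, 0 <= f t) -> [disjoint A & B] ->
  \int[mu]_(t in A) f t + \int[mu]_(t in B) f t <=
    \int[mu]_(t in A `|` B) f t.
Proof.
move=> f0 dAB; set I := leRHS.
have I0 : 0 <= I by exact: integral_ge0.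
have [->|Ioo] := eqVneq I +oo; first by rewrite leey.
have If : I \is a fin_num by rewrite ge0_fin_numE// ltey.
have add (h h' : {nnsfun T >-> R}) : (forall t, (h t)%:E <= (f \_ A) t) ->
    (forall t, (h' t)%:E <= (f \_ B) t) -> sintegral mu h + sintegral mu h' <= I.
  move=> hA hB; rewrite -sintegralD /I ge0_integralE//.
  apply: ereal_sup_ubound; exists (add_nnsfun h h') => // t /=.
  rewrite EFinD; apply: le_trans (leeD (hA t) (hB t)) _.
  rewrite !patchE in_setU; case: (boolP (t \in A)) => tA; case: (boolP (t \in B)) => tB.
  - exfalso; move: tA tB; rewrite !inE => tA tB.
    by move/disj_setPS : dAB => /(_ t (conj tA tB)).
  - by rewrite adde0.
  - by rewrite add0e.
  - by rewrite adde0.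
have IB0 : 0 <= \int[mu]_(t in B) f t by exact: integral_ge0.
have Bh (h : {nnsfun T >-> R}) : (forall t, (h t)%:E <= (f \_ A) t) ->
    sintegral mu h + \int[mu]_(t in B) f t <= I.
  move=> hA; have h0 := sintegral_ge0 mu h.
  have hI : sintegral mu h <= I.
    have := add h nnsfun0 hA; rewrite sintegral0 adde0; apply => t.
    by rewrite patchE; case: ifPn.
  have hf : sintegral mu h \is a fin_num by rewrite ge0_fin_numE// (le_lt_trans hI)// ltey.
  rewrite -leeBrDl// ge0_integralE//; apply: ge_ereal_sup => _ [h' hB <-].
  by rewrite leeBrDl//; exact: add.
have BI : \int[mu]_(t in B) f t <= I.
  have := Bh nnsfun0; rewrite sintegral0 add0e; apply => t.
  by rewrite patchE; case: ifPn.
have Bf : \int[mu]_(t in B) f t \is a fin_num by rewrite ge0_fin_numE// (le_lt_trans BI)// ltey.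
rewrite -leeBrDr// [leLHS]ge0_integralE//; apply: ge_ereal_sup => _ [h hA <-].
by rewrite leeBrDr//; exact: Bh.
Qed.

Lemma ge0_integral_subset (A B : set T) (f : T -> \bar R) :
  (forall t, 0 <= f t) -> A `<=` B ->
  \int[mu]_(t in A) f t <= \int[mu]_(t in B) f t.
Proof.
move=> f0 AB; rewrite -(setDUK AB); apply: le_trans (ge0_integral_superadd _ _) => //.
  by rewrite leeDl// integral_ge0.
by apply/disj_setPS => t [At [_ /(_ At)]].
Qed.

End Superadditivity.

(** * The inner product *)

Section InnerProduct.
Context {R : realType} {X : completeNormedModType R}.
Variables (ip : {dot X for (@idfun R)}) (hX : hilbert_norm ip).

Lemma ipC x y : ip x y = ip y x.
Proof. by rewrite hermC expr0 mul1r. Qed.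
Lemma ipDl x y z : ip (x + y) z = ip x z + ip y z.
Proof. exact: linearDl. Qed.
Lemma ipDr x y z : ip x (y + z) = ip x y + ip x z.
Proof. exact: linearDr. Qed.
Lemma ipBl x y z : ip (x - y) z = ip x z - ip y z.
Proof. exact: linearBl. Qed.
Lemma ipBr x y z : ip x (y - z) = ip x y - ip x z.
Proof. exact: linearBr. Qed.
Lemma ipZr a x y : ip x (a *: y) = a * ip x y.
Proof. exact: linearZr_LR. Qed.
Lemma ipZl a x y : ip (a *: x) y = a * ip x y.
Proof. by rewrite ipC ipZr ipC. Qed.
Lemma ip0r x : ip x 0 = 0.
Proof. exact: linear0r. Qed.
Lemma ip_sumr x I (s : seq I) (P : pred I) (F : I -> X) :
  ip x (\sum_(i <- s | P i) F i) = \sum_(i <- s | P i) ip x (F i).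
Proof. exact: linear_sumr. Qed.

(** Cauchy-Schwarz, read off the triangle inequality of the norm. *)
Lemma ip_le_norm x y : ip x y <= `|x| * `|y|.
Proof.
have : `|x + y| ^+ 2 <= (`|x| + `|y|) ^+ 2.
  by rewrite lerXn2r ?nnegrE ?addr_ge0// ler_normD.
rewrite hX ipDl !ipDr -!hX (ipC y x) sqrrD; lra.
Qed.

Lemma norm_ip x y : `|ip x y| <= `|x| * `|y|.
Proof.
rewrite ler_norml ip_le_norm andbT lerNl -mulN1r -ipZr.
by rewrite (le_trans (ip_le_norm _ _))// normrZ normrN1 mul1r.
Qed.

Lemma ip_eq x y : (forall z, ip z x = ip z y) -> x = y.
Proof.
move=> xy; apply/eqP; rewrite -subr_eq0 -normr_eq0 -sqrf_eq0 hX.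
by rewrite ipBr xy subrr.
Qed.

Lemma continuous_ip x : continuous (ip x).
Proof.
move=> y; apply/cvgrPdist_lt => e e0.
have d0 : 0 < e / (`|x| + 1) by rewrite divr_gt0// ltr_wpDl.
have /cvgrPdist_lt/(_ _ d0) yz : id z @[z --> y] --> y by exact: cvg_id.
near=> z; rewrite -ipBr (le_lt_trans (norm_ip _ _))//.
rewrite (@le_lt_trans _ _ ((`|x| + 1) * `|y - z|))//.
  by rewrite ler_wpM2r// lerDl.
rewrite mulrC -ltr_pdivlMr ?ltr_wpDl//.
Unshelve. all: by end_near. Qed.

End InnerProduct.

(** * Limits of simple functions *)

Section FinBorel.
Import HBSimple.
Context {R : realType}.

(** [simple_fun] for an arbitrary codomain: a sum or a scalar multiple of
    simple functions is the image of a simple function with values in pairs. *)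
Definition borel_simple (V : Type) (s : R -> V) : Prop :=
  finite_set (range s) /\
  forall A : set V, measurable (s @^-1` A : set (measurableTypeR R)).

Lemma borel_simpleP (X : completeNormedModType R) (s : R -> X) :
  simple_fun s <-> borel_simple s.
Proof.
split=> -[fs ms]; split => // A.
have -> : s @^-1` A = \bigcup_(y in range s `&` A) s @^-1` [set y].
  apply/seteqP; split => [t At|t [y [_ Ay] /= sty]]; last by rewrite /preimage/= sty.
  by exists (s t) => //; split => //; exists t.
apply: fin_bigcup_measurable => [|y _]; last exact: ms.
by apply: sub_finite_set fs => y [].
Qed.

Lemma borel_simple_comp (V W : Type) (k : V -> W) (s : R -> V) :
  borel_simple s -> borel_simple (k \o s).
Proof.
move=> [fs ms]; split => [|A]; last exact: (ms (k @^-1` A)).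
rewrite (_ : range (k \o s) = k @` range s); first exact: finite_image.
by rewrite image_comp.
Qed.

Lemma borel_simple_pair (V W : Type) (s : R -> V) (s' : R -> W) :
  borel_simple s -> borel_simple s' -> borel_simple (fun t => (s t, s' t)).
Proof.
move=> [fs ms] [fs' ms']; split.
  apply: sub_finite_set (finite_setX fs fs') => _ [t _ <-].
  by split; exists t.
move=> A; rewrite [X in measurable X](_ : _ =
    \bigcup_(y in range s) (s @^-1` [set y] `&` s' @^-1` [set z | A (y, z)])).
  apply: fin_bigcup_measurable => // y _; apply: measurableI; [exact: ms|exact: ms'].
apply/seteqP; split => [t At|t [y _] [/= <- //]].
by exists (s t) => //; exists t.
Qed.

Lemma borel_simple2 (V W Z : Type) (k : V -> W -> Z) (s : R -> V) (s' : R -> W) :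
  borel_simple s -> borel_simple s' -> borel_simple (fun t => k (s t) (s' t)).
Proof.
move=> bs bs'.
exact: (borel_simple_comp (fun p => k p.1 p.2) (borel_simple_pair bs bs')).
Qed.

Lemma borel_simple_measurable (s : R -> R) :
  borel_simple s -> measurable_fun [set: measurableTypeR R] s.
Proof. by move=> [_ ms] _ A _; rewrite setTI; exact: ms. Qed.

Lemma borel_simple_sfun (s : {sfun measurableTypeR R >-> R}) : borel_simple s.
Proof.
split=> [|A]; first exact: (@fimfunP (measurableTypeR R) R s).
rewrite (_ : s @^-1` A = \bigcup_(y in range s `&` A) s @^-1` [set y]).
  apply: fin_bigcup_measurable => [|y _]; last exact: measurable_sfunP.
  by apply: sub_finite_set (@fimfunP (measurableTypeR R) R s) => y [].
apply/seteqP; split => [t At|t [y [_ Ay] /= sty]]; last by rewrite /preimage/= sty.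
by exists (s t) => //; split => //; exists t.
Qed.

End FinBorel.

Section SimpleLimits.
Import HBSimple.
Context {R : realType} {X : completeNormedModType R}.
Implicit Types (f g : R -> X) (s : R -> X).

Local Notation mu := (@lebesgue_measure R).

(** Strong measurability for the Borel sigma-algebra: the limit is required
    at every point. *)
Definition simple_limit f : Prop :=
  exists s : nat -> R -> X,
    (forall n, simple_fun (s n)) /\ forall t, s n t @[n --> \oo] --> f t.

Lemma simple_limit_cst x : simple_limit (fun=> x).
Proof.
exists (fun _ _ => x); split => [n|t]; last exact: cvg_cst.
apply/borel_simpleP; split => [|A].
  by apply: sub_finite_set (finite_set1 x) => _ [t _ <-].
have [Ax|Ax] := pselect (A x).
  suff -> : (fun=> x) @^-1` A = [set: R] by []. by apply/seteqP; split.
suff -> : (fun=> x) @^-1` A = @set0 R by []. by apply/seteqP; split.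
Qed.

Lemma simple_limitB f g :
  simple_limit f -> simple_limit g -> simple_limit (fun t => f t - g t).
Proof.
move=> [s [ss sf]] [s' [ss' sg]]; exists (fun n t => s n t - s' n t).
split=> [n|t]; last by apply: cvgB; [exact: sf|exact: sg].
apply/borel_simpleP; apply: (borel_simple2 (fun x y => x - y)); exact/borel_simpleP.
Qed.

Lemma simple_limitD f g :
  simple_limit f -> simple_limit g -> simple_limit (fun t => f t + g t).
Proof.
move=> [s [ss sf]] [s' [ss' sg]]; exists (fun n t => s n t + s' n t).
split=> [n|t]; last by apply: cvgD; [exact: sf|exact: sg].
apply/borel_simpleP; apply: (borel_simple2 (fun x y => x + y)); exact/borel_simpleP.
Qed.

Lemma simple_limitZ (p : R -> R) f :
  measurable_fun [set: measurableTypeR R] p ->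
  simple_limit f -> simple_limit (fun t => p t *: f t).
Proof.
move=> mp [s [ss sf]].
have /measurable_EFinP mEp := mp.
have [q qp] := approximation_sfun (@measurableT _ (measurableTypeR R)) mEp.
exists (fun n t => q n t *: s n t); split=> [n|t]; last first.
  apply: cvgZ; last exact: sf.
  have /fine_cvgP[_] := qp t I; exact.
apply/borel_simpleP; apply: (borel_simple2 (fun x y => x *: y)).
  exact: borel_simple_sfun.
exact/borel_simpleP.
Qed.

Lemma simple_limit_measurable (k : X -> R) f :
  continuous k -> simple_limit f -> 
  measurable_fun [set: measurableTypeR R] (k \o f).
Proof.
move=> ck [s [ss sf]].
apply: (@measurable_fun_cvg _ _ _ _ (fun n => k \o s n)) => [n|t _].
  apply: borel_simple_measurable; apply: borel_simple_comp.
  exact/borel_simpleP.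
apply: continuous_cvg; [exact: ck|exact: sf].
Qed.

(** Zero is prescribed where the simple approximations may fail to converge,
    so that the limit exists everywhere. *)
Lemma strongly_measurable_rep (D : set R) f :
  measurable (D : set (measurableTypeR R)) -> strongly_measurable D f ->
  exists (g : R -> X) (N : set (measurableTypeR R)),
    [/\ measurable N, mu N = 0%E, simple_limit g &
        forall t, g t = if `[< D t /\ ~ N t >] then f t else 0].
Proof.
move=> mD [s [ss [N [mN N0 sN]]]].
exists (fun t => if `[< D t /\ ~ N t >] then f t else 0), N; split => //.
have mA : measurable ((D `\` N) : set (measurableTypeR R)) by exact: measurableD.
exists (fun n t => \1_(D `\` N) t *: s n t); split=> [n|t].
  apply/borel_simpleP; apply: (borel_simple2 (fun (x : R) (y : X) => x *: y)).
    exact: (borel_simple_sfun (indic_sfun _ mA)).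
  exact/borel_simpleP.
rewrite indicE; case: asboolP => [[Dt Nt]|DNt].
  rewrite mem_set//; under eq_fun do rewrite scale1r.
  by move: Nt; apply: contra_notP => sn; apply: sN => /= /(_ Dt).
rewrite memNset//; under eq_fun do rewrite scale0r.
exact: cvg_cst.
Qed.

End SimpleLimits.

(** * The Bochner integral tested against vectors *)

Section Bochner.
Context {R : realType} {X : completeNormedModType R}.
Variables (ip : {dot X for (@idfun R)}) (hX : hilbert_norm ip).
Implicit Types (D : set R) (f g s : R -> X).

Local Notation mu := (@lebesgue_measure R).
Local Notation mR := (measurableTypeR R).

(** [g] is a Borel representative on [D] of the class of [f] in [L^1(D; X)]. *)
Definition L1_rep D f g : Prop :=
  [/\ simple_limit g, mu.-integrable D (fun t => `|g t|%:E) &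
      exists N : set mR, [/\ measurable N, mu N = 0%E &
        forall t, D t -> ~ N t -> f t = g t]].

Lemma simple_limit_norm g : simple_limit g ->
  measurable_fun [set: mR] (fun t => `|g t|).
Proof. exact: (simple_limit_measurable (@norm_continuous _ _)). Qed.

Lemma simple_limit_ip x g : simple_limit g ->
  measurable_fun [set: mR] (fun t => ip x (g t)).
Proof. exact: simple_limit_measurable (@continuous_ip _ _ _ hX x). Qed.

Lemma simple_fun_limit s : simple_fun s -> simple_limit s.
Proof. by exists (fun=> s); split => // t; exact: cvg_cst. Qed.

Lemma integrable_normB D g s : measurable (D : set mR) ->
  simple_limit g -> simple_limit s ->
  mu.-integrable D (fun t => `|g t|%:E) ->
  mu.-integrable D (fun t => `|s t|%:E) ->
  mu.-integrable D (fun t => `|g t - s t|%:E).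
Proof.
move=> mD sg ss ig is_.
apply: (le_integrable mD _ _ (integrableD mD ig is_)).
  apply/measurable_EFinP/measurable_funTS.
  exact: simple_limit_norm (simple_limitB sg ss).
by move=> t _ /=; rewrite !lee_fin normr_id (le_trans (ler_normB _ _))// ler_norm.
Qed.

Lemma integrable_ip D x g : measurable (D : set mR) ->
  simple_limit g -> mu.-integrable D (fun t => `|g t|%:E) ->
  mu.-integrable D (fun t => (ip x (g t))%:E).
Proof.
move=> mD sg ig.
apply: (le_integrable mD _ _ (integrableZl mD `|x| ig)).
  by apply/measurable_EFinP/measurable_funTS; exact: simple_limit_ip.
move=> t _ /=; rewrite lee_fin (le_trans (norm_ip hX _ _))//.
by rewrite ler_norm.
Qed.

Lemma Rintegral_ip_le D x g : measurable (D : set mR) ->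
  simple_limit g -> mu.-integrable D (fun t => `|g t|%:E) ->
  \int[mu]_(t in D) ip x (g t) <= `|x| * \int[mu]_(t in D) `|g t|.
Proof.
move=> mD sg ig; rewrite -RintegralZl//.
apply: le_Rintegral => //; [exact: integrable_ip|exact: (integrableZl mD `|x| ig)|].
by move=> t _; exact: ip_le_norm.
Qed.

(** Testing against [x] itself bounds the norm. *)
Lemma norm_le_dual x c : 0 <= c -> (forall z, ip z x <= `|z| * c) -> `|x| <= c.
Proof.
move=> c0 /(_ x); rewrite -hX expr2.
have [->|x0] := eqVneq x 0; first by rewrite normr0.
by rewrite ler_pM2l// normr_gt0.
Qed.

Section SimpleIntegral.
Variables (D : set R) (s : R -> X).
Hypotheses (mD : measurable (D : set mR)) (Doo : (mu D < +oo)%E).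
Hypothesis ss : simple_fun s.

Let preim_lty y : (mu (D `&` s @^-1` [set y]) < +oo)%E.
Proof.
apply: le_lt_trans Doo; apply: le_measure; rewrite ?inE//.
  by apply: measurableI => //; exact: ss.2.
Qed.

Let decomp (k : X -> R) t : (k (s t))%:E =
  (\sum_(y <- finmap.enum_fset (fset_set (range s)))
     (k y)%:E * (\1_(s @^-1` [set y]) t)%:E)%E.
Proof.
rewrite (bigD1_seq (s t))/=; last first.
- exact: finmap.fset_uniq.
- by rewrite in_fset_set ?inE; [exists t|exact: ss.1].
rewrite indicE mem_set// mule1 big1 ?adde0// => y ys.
by rewrite indicE memNset ?mule0// => /= /esym /eqP; apply/negP.
Qed.

Let int_indic (k : X -> R) y :
  mu.-integrable D (fun t => ((k y)%:E * (\1_(s @^-1` [set y]) t)%:E)%E).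
Proof.
apply: integrableZl => //; apply/integrableP; split.
  apply/measurable_EFinP/measurable_indic; exact: ss.2.
rewrite [ltLHS](_ : _ = \int[mu]_(t in D) (\1_(s @^-1` [set y]) t)%:E)%E.
  by rewrite integral_indic//; [rewrite setIC; exact: preim_lty|exact: ss.2].
by apply: eq_integral => t _; rewrite gee0_abs// lee_fin.
Qed.

Lemma simple_fun_integrable (k : X -> R) :
  mu.-integrable D (fun t => (k (s t))%:E).
Proof.
rewrite (funext (decomp k)).
by apply: (integrable_sum mD) => y _; exact: int_indic.
Qed.

Lemma Rintegral_simple_fun (k : X -> R) :
  \int[mu]_(t in D) k (s t) =
  \sum_(y \in range s) fine (mu (D `&` s @^-1` [set y])) * k y.
Proof.
rewrite /Rintegral; under eq_integral do rewrite decomp.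
rewrite integral_sum// fsbig_finite; last exact: ss.1.
rewrite (eq_bigr (fun y => (fine (mu (D `&` s @^-1` [set y])) * k y)%:E)).
  by rewrite sumEFin.
move=> y _; rewrite integralZl//; last first.
  have := int_indic (fun=> 1) y; under eq_fun do rewrite mul1e; exact.
rewrite integral_indic//; last exact: ss.2.
rewrite EFinM muleC fineK; first by rewrite setIC.
by rewrite ge0_fin_numE; [exact: preim_lty|exact: measure_ge0].
Qed.

(** The weak form of the simple integral; everything about vector-valued
    integrals is derived from it. *)
Lemma simple_integral_ip x :
  ip x (simple_integral D s) = \int[mu]_(t in D) ip x (s t).
Proof.
rewrite Rintegral_simple_fun /simple_integral !fsbig_finite; try exact: ss.1.
by rewrite ip_sumr; apply: eq_bigr => y _; rewrite ipZr.
Qed.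

End SimpleIntegral.

End Bochner.

Section BochnerExistence.
Context {R : realType} {X : completeNormedModType R}.
Variables (ip : {dot X for (@idfun R)}) (hX : hilbert_norm ip).
Implicit Types (D : set R) (f g s : R -> X).

Local Notation mu := (@lebesgue_measure R).
Local Notation mR := (measurableTypeR R).

Lemma simple_fun_integrable_norm D s : measurable (D : set mR) ->
  (mu D < +oo)%E -> simple_fun s -> mu.-integrable D (fun t => `|s t|%:E).
Proof. by move=> mD Doo ss; exact: (simple_fun_integrable mD Doo ss (fun x => `|x|)). Qed.

(** The weak identity bounds the inner products of the difference with all
    vectors, hence its norm. *)
Lemma simple_integral_dist D s s' : measurable (D : set mR) ->
  (mu D < +oo)%E -> simple_fun s -> simple_fun s' ->
  `|simple_integral D s - simple_integral D s'| <=
    \int[mu]_(t in D) `|s t - s' t|.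
Proof.
move=> mD Doo ss ss'; apply: (norm_le_dual hX); first exact: Rintegral_ge0.
have sl := simple_fun_limit ss; have sl' := simple_fun_limit ss'.
have is_ := simple_fun_integrable_norm mD Doo ss.
have is_' := simple_fun_integrable_norm mD Doo ss'.
move=> z; rewrite ipBr !(simple_integral_ip ip mD Doo)// -RintegralB//; last 2 first.
  exact: (integrable_ip hX z mD sl is_).
  exact: (integrable_ip hX z mD sl' is_').
under eq_Rintegral do rewrite -ipBr.
apply: (Rintegral_ip_le hX z mD).
  exact: simple_limitB.
exact: integrable_normB.
Qed.

(** Replacing [s n t] by [0] whenever it is too large compared with the limit
    does not affect convergence: this is clear where [g t = 0], and elsewhere
    [s n t] is eventually close to [g t].  The bound makes dominated
    convergence applicable. *)
Lemma simple_limit_dominated g : simple_limit g ->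
  exists s : nat -> R -> X, [/\ forall n, simple_fun (s n),
    forall t, s n t @[n --> \oo] --> g t &
    forall n t, `|s n t| <= 2 * `|g t|].
Proof.
move=> sg; have [s [ss sgt]] := sg.
pose A n := [set t | `|s n t| <= 2 * `|g t|].
have mA n : measurable (A n : set mR).
  rewrite (_ : A n = setT `&` [set t | `|s n t| <= 2 * `|g t|]); last by rewrite setTI.
  apply: measurable_fun_le => //.
    exact: (simple_limit_norm (simple_fun_limit (ss n))).
  by apply: measurable_funM => //; exact: simple_limit_norm.
exists (fun n t => \1_(A n) t *: s n t); split.
- move=> n; apply/borel_simpleP.
  apply: (borel_simple2 (fun (x : R) (y : X) => x *: y)).
    exact: (borel_simple_sfun (indic_sfun _ (mA n))).
  exact/borel_simpleP.
- move=> t; have [gt0|gt0] := eqVneq (g t) 0.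
    rewrite gt0; apply: cvg_near_cst; near=> n; rewrite indicE.
    have [|] := boolP (t \in A n); last by rewrite scale0r.
    by rewrite inE /A/= gt0 normr0 mulr0 normr_le0 scale1r => /eqP.
  have nt0 : 0 < `|g t| by rewrite normr_gt0.
  apply: cvg_trans (sgt t); apply: near_eq_cvg.
  have /cvgrPdist_lt/(_ _ nt0) := sgt t; apply: filterS => n gs.
  rewrite indicE mem_set ?scale1r// /A/=.
  rewrite -(subKr (g t) (s n t)) (le_trans (ler_normB _ _))// mulr2n mulrDl !mul1r.
  by rewrite lerD2l ltW.
- move=> n t; rewrite normrZ indicE; have [|_] := boolP (t \in A n).
    by rewrite inE /A/= normr1 mul1r.
  by rewrite normr0 mul0r mulr_ge0.
Unshelve. all: by end_near. Qed.

(** Existence of the integral: by [simple_integral_dist] the integrals of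
    approximations that converge in [L^1] form a Cauchy sequence. *)
Lemma L1_rep_is_bochner D f g : measurable (D : set mR) -> (mu D < +oo)%E ->
  L1_rep D f g -> exists x, is_bochner_integral D f x.
Proof.
move=> mD Doo [sg ig [N [mN N0 fg]]].
have [s [ss sgt sle]] := simple_limit_dominated sg.
have sl n := simple_fun_limit (ss n).
have is_ n := simple_fun_integrable_norm mD Doo (ss n).
have i3g : mu.-integrable D (fun t => (3%:E * `|g t|%:E)%E) by exact: integrableZl.
have iB n := integrable_normB mD sg (sl n) ig (is_ n).
have mB n : measurable_fun D (fun t => `|g t - s n t|%:E).
  exact: measurable_int (iB n).
have cvB : {ae mu, forall t, D t -> `|g t - s n t|%:E @[n --> \oo] --> 0%E}.
  apply: aeW => t _; apply/cvg_EFin; first exact: nearW.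
  rewrite -(normr0 X) -(subrr (g t)).
  by apply: cvg_norm; apply: cvgB; [exact: cvg_cst|exact: sgt].
have leB : {ae mu, forall t n, D t -> (`| `|g t - s n t|%:E | <= 3%:E * `|g t|%:E)%E}.
  apply: aeW => t n _; rewrite /= normr_id lee_fin (le_trans (ler_normB _ _))//.
  by have := sle n t; lra.
have [_ _ ] := dominated_convergence mD mB (measurable_cst _) cvB i3g leB.
rewrite integral0 => cv {cvB leB mB i3g}.
have cvI : (fun n => \int[mu]_(t in D) `|g t - s n t|) @ \oo --> 0.
  exact: fine_cvg cv.
pose I n := simple_integral D (s n).
have dI n m : `|I n - I m| <=
    \int[mu]_(t in D) `|g t - s n t| + \int[mu]_(t in D) `|g t - s m t|.
  apply: le_trans (simple_integral_dist mD Doo (ss n) (ss m)) _.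
  rewrite -RintegralD; [|exact: mD|exact: iB|exact: iB].
  apply: (le_Rintegral mD).
  - exact: integrable_normB.
  - exact: (integrableD mD (iB n) (iB m)).
  move=> t _; rewrite distrC.
  rewrite -[X in `|X|](_ : (g t - s n t) - (g t - s m t) = _) ?ler_normB//.
  by rewrite opprB addrC addrA subrK.
have cI : cvgn I.
  apply/cauchy_cvgP/cauchy_exP => e e0.
  have e20 : 0 < e / 2 by rewrite divr_gt0.
  have /cvgrPdist_lt/(_ _ e20)[k _ kI] := cvI.
  exists (I k); exists k => // n kn; rewrite -ball_normE; apply: le_lt_trans (dI k n) _.
  rewrite (splitr e) ltrD//.
    by have := kI k (leqnn _); rewrite sub0r normrN; apply: le_lt_trans; exact: ler_norm.
  by have := kI n kn; rewrite sub0r normrN; apply: le_lt_trans; exact: ler_norm.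
exists (lim (I @ \oo)), s; split => //.
- split => //; exists N; split => // t /= /not_implyP[Dt ns].
  by apply: contra_notP ns => Nt; rewrite fg.
- rewrite [X in X @ _ --> _](_ : _ = fun n => \int[mu]_(t in D) `|g t - s n t|%:E)%E //.
  apply/funext => n; apply: (integral_off_null mN N0) => t Dt Nt.
  by rewrite fg.
Qed.

(** Every approximating sequence admitted by the definition gives these weak
    values, so they determine the vector that [bochner_integral] selects. *)
Lemma bochner_integral_ip D f g : measurable (D : set mR) -> (mu D < +oo)%E ->
  L1_rep D f g ->
  forall x, ip x (bochner_integral D f) = \int[mu]_(t in D) ip x (g t).
Proof.
move=> mD Doo fgr x; have [y0 y0f] := L1_rep_is_bochner mD Doo fgr.
have [sg ig [N [mN N0 fg]]] := fgr.
have : is_bochner_integral D f (bochner_integral D f) by apply: (xgetPex 0); exists y0.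
move: (bochner_integral D f) => y [s [[ss sf] cv cI]].
have sl n := simple_fun_limit (ss n).
have is_ n := simple_fun_integrable_norm mD Doo (ss n).
have iB n := integrable_normB mD sg (sl n) ig (is_ n).
have cvI : (fun n => \int[mu]_(t in D) `|g t - s n t|) @ \oo --> 0.
  apply: fine_cvg.
  rewrite [X in X @ _ --> _](_ : _ = fun n => \int[mu]_(t in D) `|f t - s n t|%:E)%E //.
  apply/funext => n; apply: (integral_off_null mN N0) => t Dt Nt.
  by rewrite fg.
have cx : (fun n => ip x (simple_integral D (s n))) @ \oo --> ip x y.
  by apply: continuous_cvg => //; exact: (continuous_ip hX).
apply/esym; apply: (cvg_unique _ _ cx) => //.
apply/cvgrPdist_le => e e0.
have e1 : 0 < e / (`|x| + 1) by rewrite divr_gt0// ltr_wpDl.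
have /cvgrPdist_lt/(_ _ e1) := cvI; apply: filterS => n.
rewrite sub0r normrN ger0_norm ?Rintegral_ge0// => xn.
rewrite (simple_integral_ip ip mD Doo)// -RintegralB//; last 2 first.
  exact: (integrable_ip hX x mD sg ig).
  exact: (integrable_ip hX x mD (sl n) (is_ n)).
under eq_Rintegral do rewrite -ipBr.
have sB := simple_limitB sg (sl n).
apply: le_trans (le_normr_Rintegral mD (integrable_ip hX x mD sB (iB n))) _.
apply: (@le_trans _ _ (\int[mu]_(t in D) ((`|x| + 1) * `|g t - s n t|))).
  apply: le_Rintegral => //.
  - by have := integrable_abse (integrable_ip hX x mD sB (iB n)).
  - exact: (integrableZl mD _ (iB n)).
  move=> t _; rewrite (le_trans (norm_ip hX _ _))// ler_wpM2r// lerDl//.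
rewrite RintegralZl; [|exact: mD|exact: iB].
by rewrite mulrC -ler_pdivlMr ?ltr_wpDl// ltW.
Qed.

End BochnerExistence.

(** * Borel representatives of integrable functions *)

Section L1Representatives.
Context {R : realType} {X : completeNormedModType R}.
Implicit Types (D : set R) (f g : R -> X).

Local Notation mu := (@lebesgue_measure R).
Local Notation mR := (measurableTypeR R).

Lemma lebesgue_measure_itv_lty (a b : R) : (mu `]a, b[ < +oo)%E.
Proof. by rewrite lebesgue_measure_itv/=; case: ifPn => // _; rewrite -EFinB ltry. Qed.

Lemma integrable_cst D (c : R) : measurable (D : set mR) -> (mu D < +oo)%E ->
  mu.-integrable D (fun=> c%:E).
Proof.
move=> mD Doo; apply/integrableP; split; first exact: measurable_cst.
by rewrite integral_cst// lte_mul_pinfty.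
Qed.

Lemma LpX_norm1E D f : LpX_norm 1%E D f = (\int[mu]_(t in D) `|f t|%:E)%E.
Proof.
rewrite /LpX_norm Lnorm1 [RHS]integral_mkcond; apply: eq_integral => t _.
by rewrite patchE; case: ifPn => _; rewrite ?abse0//= normr_id.
Qed.

Lemma L1_rep_Rintegral D f g (k : R -> X -> R) : L1_rep D f g ->
  \int[mu]_(t in D) k t (f t) = \int[mu]_(t in D) k t (g t).
Proof.
move=> [_ _ [N [mN N0 fg]]].
by apply: (Rintegral_off_null mN N0) => t Dt Nt; rewrite fg.
Qed.

Lemma L1_rep_LpX1 D f : measurable (D : set mR) -> LpX 1%E D f ->
  exists g, L1_rep D f g.
Proof.
move=> mD [/(strongly_measurable_rep mD)[g [N [mN N0 sg gE]]]].
rewrite LpX_norm1E => foo.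
have fg t : D t -> ~ N t -> f t = g t.
  by move=> Dt Nt; rewrite gE; case: asboolP => // -[].
exists g; split => //; last by exists N.
apply/integrableP; split.
  by apply/measurable_EFinP/measurable_funTS; exact: simple_limit_norm.
rewrite (@integral_off_null _ _ _ mu D N _ (fun t => `|f t|%:E)) //.
by move=> t Dt Nt; rewrite fg//= normr_id.
Qed.

(** On a set of finite measure, [|g| <= 1 + |g| ^ 2] is integrable. *)
Lemma L1_rep_LpX2 D f : measurable (D : set mR) -> (mu D < +oo)%E ->
  LpX 2%:E D f -> exists g, L1_rep D f g.
Proof.
move=> mD Doo [/(strongly_measurable_rep mD)[g [N [mN N0 sg gE]]] foo].
have fg t : D t -> ~ N t -> f t = g t.
  by move=> Dt Nt; rewrite gE; case: asboolP => // -[].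
have mg : measurable_fun D (fun t => `|g t|).
  by apply/measurable_funTS; exact: simple_limit_norm.
have ig2 : mu.-integrable D (fun t => (`|g t| ^+ 2)%:E).
  apply/integrableP; split; first by apply/measurable_EFinP; exact: measurable_funX.
  rewrite (@integral_off_null _ _ _ mu D N _ (fun t => (`|f t| ^+ 2)%:E)) //; last first.
    by move=> t Dt Nt; rewrite fg//= ger0_norm.
  rewrite ltey; apply/eqP => foo2; move: foo.
  rewrite /LpX_norm unlock.
  rewrite (_ : (\int[mu]_x _)%E = \int[mu]_(t in D) (`|f t| ^+ 2)%:E)%E; last first.
    rewrite [RHS]integral_mkcond; apply: eq_integral => t _.
    rewrite !patchE; case: ifPn => _.
      by rewrite /= normr_id powR_mulrn.
    by rewrite abse0 poweR_EFin powR0 ?pnatr_eq0.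
  by rewrite foo2 poweRyr ?ltxx// invr_neq0// pnatr_eq0.
exists g; split => //; last by exists N.
have i1 : mu.-integrable D (fun=> 1%:E) by exact: integrable_cst.
apply: (le_integrable mD _ _ (integrableD mD i1 ig2)).
  exact/measurable_EFinP.
move=> t _ /=; rewrite lee_fin normr_id [leRHS]ger0_norm; last by rewrite addr_ge0// sqr_ge0.
by have := sqr_ge0 (`|g t| - 1); rewrite sqrrB; have := normr_ge0 (g t); nra.
Qed.

Lemma L1_repS D D' f g : measurable (D : set mR) -> measurable (D' : set mR) ->
  D' `<=` D -> L1_rep D f g -> L1_rep D' f g.
Proof.
move=> mD mD' DD [sg ig [N [mN N0 fg]]]; split => //.
  exact: integrableS ig.
by exists N; split => // t /DD; exact: fg.
Qed.

Lemma L1_repD D f g f' g' : measurable (D : set mR) ->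
  L1_rep D f g -> L1_rep D f' g' ->
  L1_rep D (fun t => f t + f' t) (fun t => g t + g' t).
Proof.
move=> mD [sg ig [N [mN N0 fg]]] [sg' ig' [N' [mN' N0' fg']]]; split.
- exact: simple_limitD.
- apply: (le_integrable mD _ _ (integrableD mD ig ig')).
    apply/measurable_EFinP/measurable_funTS; apply: simple_limit_norm.
    exact: simple_limitD.
  move=> t _ /=; rewrite !lee_fin normr_id (le_trans (ler_normD _ _))//.
  by rewrite ler_norm.
- exists (N `|` N'); split; first exact: measurableU.
    by rewrite measureU0.
  by move=> t Dt /not_orP[Nt Nt']; rewrite fg// fg'.
Qed.

Lemma L1_repZ D (p : R -> R) (K : R) f g : measurable (D : set mR) ->
  measurable_fun [set: mR] p -> (forall t, D t -> `|p t| <= K) ->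
  L1_rep D f g -> L1_rep D (fun t => p t *: f t) (fun t => p t *: g t).
Proof.
move=> mD mp pK [sg ig [N [mN N0 fg]]]; split.
- exact: simple_limitZ.
- apply: (le_integrable mD _ _ (integrableZl mD K ig)).
    apply/measurable_EFinP/measurable_funTS; apply: simple_limit_norm.
    exact: simple_limitZ.
  move=> t Dt /=; rewrite !lee_fin normr_id normrZ normrM normr_id.
  by rewrite ler_wpM2r// (le_trans (pK _ Dt))// ler_norm.
- by exists N; split => // t Dt Nt; rewrite fg.
Qed.

Lemma L1_repB D f g f' g' : measurable (D : set mR) ->
  L1_rep D f g -> L1_rep D f' g' ->
  L1_rep D (fun t => f t - f' t) (fun t => g t - g' t).
Proof.
move=> mD fg fg'.
have nfg' : L1_rep D (fun t => -1 *: f' t) (fun t => -1 *: g' t).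
  apply: (L1_repZ (K := 1) (p := fun=> -1)) => //.
  by move=> t _; rewrite normrN1.
have eB (h h' : R -> X) : (fun t => h t - h' t) = (fun t => h t + -1 *: h' t).
  by apply/funext => t; rewrite scaleN1r.
by rewrite !eB; exact: L1_repD.
Qed.

Lemma L1_rep_cst D x : measurable (D : set mR) -> (mu D < +oo)%E ->
  L1_rep D (fun=> x : X) (fun=> x : X).
Proof.
move=> mD Doo; split; first exact: simple_limit_cst.
  exact: integrable_cst.
by exists set0; split.
Qed.

Lemma L1_rep_expr (a b : R) i f g : L1_rep `]a, b[ f g ->
  L1_rep `]a, b[ (fun t => t ^+ i *: f t) (fun t => t ^+ i *: g t).
Proof.
apply: (L1_repZ (p := fun t => t ^+ i) (K := (`|a| + `|b|) ^+ i)) => //.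
move=> t /=; rewrite in_itv/= => /andP[ta tb].
rewrite normrX lerXn2r ?nnegrE ?addr_ge0// ler_norml; apply/andP; split.
  by have := ler_norm (- a); have := normr_ge0 b; rewrite normrN; lra.
by have := ler_norm b; have := normr_ge0 a; lra.
Qed.

Lemma L1_rep_sum D n (F G : 'I_n -> R -> X) : measurable (D : set mR) ->
  (mu D < +oo)%E -> (forall i, L1_rep D (F i) (G i)) ->
  L1_rep D (fun t => \sum_(i < n) F i t) (fun t => \sum_(i < n) G i t).
Proof.
move=> mD Doo; elim: n F G => [|n IH] F G FG.
  under eq_fun do rewrite big_ord0.
  under [X in L1_rep _ _ X]eq_fun do rewrite big_ord0.
  exact: L1_rep_cst.
under eq_fun do rewrite big_ord_recr/=.
under [X in L1_rep _ _ X]eq_fun do rewrite big_ord_recr/=.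
by apply: L1_repD => //; exact: IH.
Qed.

Lemma L1_rep_Xpoly (a b : R) r (P : R -> X) : Xpoly r P -> L1_rep `]a, b[ P P.
Proof.
move=> [c Pc].
rewrite (_ : P = fun t => \sum_(i < r.+1) t ^+ i *: c i); last exact/funext.
apply: L1_rep_sum => // [|i]; first exact: lebesgue_measure_itv_lty.
by apply: L1_rep_expr; apply: L1_rep_cst => //; exact: lebesgue_measure_itv_lty.
Qed.

End L1Representatives.

(** * Polynomials on an interval *)

Section PolynomialIntegrals.
Context {R : realType}.
Implicit Types (a b t : R) (p q : {poly R}).

Local Notation mu := (@lebesgue_measure R).
Local Notation mR := (measurableTypeR R).

(** The coefficient of degree [0] is a division by zero, which is [0]. *)
Definition primitive p : {poly R} :=
  \poly_(i < (size p).+1) (p`_i.-1 / i%:R).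

Lemma deriv_primitive p : (primitive p)^`() = p.
Proof.
apply/polyP => i; rewrite coef_deriv coef_poly ltnS /=.
case: ltnP => ip; last by rewrite mul0rn nth_default.
by rewrite -[LHS]mulr_natr divfK// pnatr_eq0.
Qed.

Lemma integrable_horner a b p : mu.-integrable `]a, b[ (fun t => (p.[t])%:E).
Proof.
apply: (@integrableS _ mR R mu `[a, b]%classic) => //.
  exact: subset_itv_oo_cc.
apply: continuous_compact_integrable; first exact: segment_compact.
by apply: continuous_subspaceT => t; exact: continuous_horner.
Qed.

Lemma Rintegral_deriv a b p : a <= b ->
  \int[mu]_(t in `]a, b[) (p^`()).[t] = p.[b] - p.[a].
Proof.
rewrite le_eqVlt => /predU1P[->|ab].
  by rewrite subrr set_itv_ge ?Rintegral_set0// -leNgt bnd_simp.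
have cp q : {within `[a, b], continuous (horner q)}.
  by apply: continuous_subspaceT => t; exact: continuous_horner.
rewrite /Rintegral -(integral_itv_bndoo true false); last first.
  apply/measurable_EFinP.
  by have /integrableP[/measurable_EFinP] := integrable_horner a b p^`().
rewrite (@continuous_FTC2 _ _ (horner p))//.
- split=> [t _||]; first exact: derivable_horner.
  + exact/cvg_at_right_filter/continuous_horner.
  + exact/cvg_at_left_filter/continuous_horner.
- by move=> t _; rewrite derivE.
Qed.

Lemma Rintegral_sum (D : set R) n (F : 'I_n -> R -> R) : measurable (D : set mR) ->
  (forall i, mu.-integrable D (EFin \o F i)) ->
  \int[mu]_(t in D) (\sum_(i < n) F i t) = \sum_(i < n) \int[mu]_(t in D) F i t.
Proof.
move=> mD iF; elim: n F iF => [|n IH] F iF.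
  under eq_Rintegral do rewrite big_ord0.
  by rewrite big_ord0 /Rintegral integral0.
under eq_Rintegral do rewrite big_ord_recr/=.
rewrite RintegralD//; last first.
  rewrite (_ : _ \o _ =
    fun t => (\sum_(i < n) (F (widen_ord (leqnSn n) i) t)%:E)%E); last first.
    by apply/funext => t /=; rewrite sumEFin.
  by apply: (integrable_sum mD) => i _; exact: iF.
by rewrite big_ord_recr/= IH.
Qed.

(** There are [size p] equidistant roots, one more than the degree allows. *)
Lemma poly_itv_eq0 a b p : a < b -> (forall t, a <= t <= b -> p.[t] = 0) -> p = 0.
Proof.
move=> ab p0; apply/eqP; apply/negPn/negP => pn0.
pose node i := a + (b - a) * (i%:R / (size p)%:R).
have sp : (0 < size p)%N by rewrite size_poly_gt0.
have sp0 : (0 : R) < (size p)%:R by rewrite ltr0n.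
have := max_poly_roots pn0 (rs := [seq node i | i <- iota 0 (size p)]).
rewrite size_map size_iota ltnn => H; apply/notF/H; clear H.
  apply/allP => x /mapP[i]; rewrite mem_iota add0n => /andP[_ ip] ->.
  rewrite rootE p0// /node; apply/andP; split.
    by rewrite lerDl mulr_ge0 ?divr_ge0// subr_ge0 ltW.
  rewrite -lerBrDl; apply: ler_piMr; first by rewrite subr_ge0 ltW.
  rewrite ler_pdivrMr// mul1r ler_nat.
  exact: ltnW.
rewrite map_inj_uniq ?iota_uniq// => i j /addrI/mulfI ij.
have /ij : b - a != 0 by rewrite subr_eq0 gt_eqF.
by move/(divIf (lt0r_neq0 sp0))/eqP; rewrite eqr_nat => /eqP.
Qed.

(** The primitive of [p ^ 2] is nondecreasing with equal values at [a] and
    [b], hence constant. *)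
Lemma Rintegral_sqr_eq0 a b p : a < b ->
  \int[mu]_(t in `]a, b[) (p.[t] * p.[t]) = 0 -> p = 0.
Proof.
move=> ab; pose Q := primitive (p * p).
have Qint x y : x <= y -> 0 <= Q.[y] - Q.[x].
  move=> xy; rewrite -(Rintegral_deriv _ xy) deriv_primitive.
  by apply: Rintegral_ge0 => t _; rewrite hornerM -expr2 sqr_ge0.
under eq_Rintegral do rewrite -hornerM -(deriv_primitive (p * p)).
rewrite Rintegral_deriv ?ltW// => /eqP; rewrite subr_eq0 => /eqP Qab.
have QC : Q - Q.[a]%:P = 0.
  apply: (poly_itv_eq0 ab) => t /andP[at_ tb]; rewrite hornerD hornerN hornerC.
  apply/eqP; rewrite eq_le Qint// andbT.
  by have := Qint _ _ tb; rewrite -/Q in Qab *; rewrite Qab subr_ge0 subr_le0.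
have := congr1 (fun q => q^`()) QC.
rewrite derivB derivC subr0 deriv0 deriv_primitive => /eqP.
by rewrite mulf_eq0 orbb => /eqP.
Qed.

(** The Gram matrix of the monomials for the [L^2] product on [(a,b)]. *)
Definition gram r a b : 'M[R]_r.+1 :=
  \matrix_(i, j) \int[mu]_(t in `]a, b[) t ^+ (i + j).

Lemma integrable_expr a b (c : R) k :
  mu.-integrable `]a, b[ (fun t => (c * t ^+ k)%:E).
Proof.
rewrite (_ : (fun t => _) = fun t => ((c *: 'X^k).[t])%:E).
  exact: integrable_horner.
by apply/funext => t; rewrite hornerZ hornerXn.
Qed.

Lemma integrable_exprn a b k : mu.-integrable `]a, b[ (fun t => (t ^+ k)%:E).
Proof.
rewrite (_ : (fun t => _) = fun t => ('X^k.[t])%:E).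
  exact: integrable_horner.
by apply/funext => t; rewrite hornerXn.
Qed.

Lemma integrable_sum_expr a b n (c : 'I_n -> R) (k : 'I_n -> nat) :
  mu.-integrable `]a, b[ (EFin \o fun t => \sum_(i < n) c i * t ^+ k i).
Proof.
rewrite (_ : _ \o _ = fun t => ((\sum_(i < n) c i *: 'X^(k i)).[t])%:E).
  exact: integrable_horner.
apply/funext => t /=; rewrite horner_sum; congr EFin; apply: eq_bigr => i _.
by rewrite hornerZ hornerXn.
Qed.

(** A kernel vector [v] is the coefficient vector of a polynomial whose square
    has integral [v G v^T = 0]. *)
Lemma gram_unit r a b : a < b -> gram r a b \in unitmx.
Proof.
move=> ab; rewrite -row_free_unit; apply: inj_row_free => v vG.
suff /(congr1 (fun p : {poly R} => poly_rV p : 'rV[R]_r.+1)) : rVpoly v = 0.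
  by rewrite rVpolyK linear0.
apply: (Rintegral_sqr_eq0 ab).
have pE t : (rVpoly v).[t] = \sum_(i < r.+1) v 0 i * t ^+ i.
  rewrite /rVpoly horner_poly; apply: eq_bigr => i _.
  by rewrite valK.
have -> : \int[mu]_(t in `]a, b[) ((rVpoly v).[t] * (rVpoly v).[t]) =
    \sum_(j < r.+1) \int[mu]_(t in `]a, b[) (\sum_(i < r.+1) (v 0 i * v 0 j) * t ^+ (i + j)).
  rewrite -Rintegral_sum//; last first.
    by move=> j; exact: integrable_sum_expr.
  apply: eq_Rintegral => t _; rewrite pE [LHS]mulr_sumr; apply: eq_bigr => j _.
  rewrite mulr_suml; apply: eq_bigr => i _.
  by rewrite exprD; ring.
apply: big1 => j _; rewrite Rintegral_sum//; last first.
  by move=> i; exact: integrable_expr.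
have E : v 0 j * (v *m gram r a b) 0 j = 0 by rewrite vG mxE mulr0.
rewrite -[RHS]E mxE mulr_sumr; apply: eq_bigr => i _.
rewrite mxE RintegralZl//; first by ring.
exact: integrable_exprn.
Qed.

(** The coefficients of the lifting polynomial solve a linear system with the
    Gram matrix; its defining property, tested against the constant [1], gives
    its integral. *)
Lemma Rintegral_lift_poly r a b : a < b ->
  \int[mu]_(t in `]a, b[) (lift_poly r a b).[t] = 1.
Proof.
move=> ab; have GV := mulmxV (gram_unit r ab).
pose l : 'cV[R]_r.+1 := invmx (gram r a b) *m \col_i a ^+ i.
have lE i : \sum_(j < r.+1) gram r a b i j * l j 0 = a ^+ i.
  have : (gram r a b *m l) i 0 = a ^+ i by rewrite mulmxA GV mul1mx mxE.
  by rewrite mxE.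
have : [set L : {poly R} | (size L <= r.+1)%N /\ forall q : {poly R}, (size q <= r.+1)%N ->
    \int[mu]_(t in `]a, b[) (L.[t] * q.[t]) = q.[a]] (lift_poly r a b).
  apply: (xgetPex 0); exists (\poly_(j < r.+1) l (inord j) 0); split; first exact: size_poly.
  move=> q sq.
  have -> : \int[mu]_(t in `]a, b[) ((\poly_(j < r.+1) l (inord j) 0).[t] * q.[t]) =
    \sum_(i < r.+1) \int[mu]_(t in `]a, b[) (\sum_(j < r.+1) (q`_i * l j 0) * t ^+ (i + j)).
    rewrite -Rintegral_sum//; last first.
      by move=> i; exact: integrable_sum_expr.
    apply: eq_Rintegral => t _; rewrite horner_poly (horner_coef_wide _ sq) [LHS]mulr_sumr.
    apply: eq_bigr => i _; rewrite mulr_suml; apply: eq_bigr => j _.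
    by rewrite inord_val exprD; ring.
  rewrite (horner_coef_wide _ sq); apply: eq_bigr => i _; rewrite Rintegral_sum//; last first.
    by move=> j; exact: integrable_expr.
  rewrite -lE mulr_sumr; apply: eq_bigr => j _.
  rewrite [gram _ _ _ _ _]mxE RintegralZl//; first by ring.
  exact: integrable_exprn.
move=> [_ /(_ 1)]; rewrite size_poly1 hornerC => <-//.
by apply: eq_Rintegral => t _; rewrite hornerC mulr1.
Qed.

End PolynomialIntegrals.

(** * The L2 projection of vector-valued functions *)

Section L2Projection.
Context {R : realType} {X : completeNormedModType R}.
Variables (ip : {dot X for (@idfun R)}) (hX : hilbert_norm ip).
Implicit Types (a b : R) (W g : R -> X).

Local Notation mu := (@lebesgue_measure R).
Local Notation mR := (measurableTypeR R).

Lemma Xpoly_cst r (x : X) : Xpoly r (fun=> x).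
Proof.
exists (fun i => if i == ord0 then x else 0) => t.
by rewrite big_ord_recl/= expr0 scale1r big1 ?addr0// => i _; rewrite scaler0.
Qed.

Lemma Rintegral_ip_Xpoly a b n (c : 'I_n -> X) k x :
  \int[mu]_(t in `]a, b[) (t ^+ k * ip x (\sum_(j < n) t ^+ j *: c j)) =
  \sum_(j < n) (\int[mu]_(t in `]a, b[) t ^+ (k + j)) * ip x (c j).
Proof.
transitivity (\int[mu]_(t in `]a, b[) (\sum_(j < n) ip x (c j) * t ^+ (k + j))).
  apply: eq_Rintegral => t _; rewrite ip_sumr mulr_sumr; apply: eq_bigr => j _.
  by rewrite ipZr exprD; ring.
rewrite Rintegral_sum// => [|j]; last exact: integrable_expr.
apply: eq_bigr => j _; rewrite RintegralZl//; first by rewrite mulrC.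
exact: integrable_exprn.
Qed.

(** The coefficients of the projection solve the normal equations, whose
    right-hand sides are the vector moments of [W]. *)
Lemma L2proj_exists r a b W g : a < b -> L1_rep `]a, b[ W g ->
  exists P, is_L2proj ip r a b W P.
Proof.
move=> ab Wg; have GV := mulmxV (gram_unit r ab).
have Doo := lebesgue_measure_itv_lty a b.
pose m (i : 'I_r.+1) := bochner_integral `]a, b[ (fun t => t ^+ i *: W t).
have mE i x : ip x (m i) = \int[mu]_(t in `]a, b[) (t ^+ i * ip x (g t)).
  rewrite (bochner_integral_ip hX _ Doo (L1_rep_expr i Wg))//.
  by apply: eq_Rintegral => t _; rewrite ipZr.
pose c j := \sum_(i < r.+1) invmx (gram r a b) j i *: m i.
have cE i : \sum_(j < r.+1) gram r a b i j *: c j = m i.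
  rewrite /c; under eq_bigr do rewrite scaler_sumr.
  rewrite exchange_big/= (bigD1 i)//= [X in _ + X]big1 => [|k ki].
    rewrite addr0; under eq_bigr do rewrite scalerA.
    rewrite -scaler_suml; have := congr1 (fun A : 'M[R]_r.+1 => A i i) GV.
    by rewrite !mxE eqxx => ->; rewrite scale1r.
  under eq_bigr do rewrite scalerA.
  rewrite -scaler_suml; have := congr1 (fun A : 'M[R]_r.+1 => A i k) GV.
  by rewrite !mxE eq_sym (negbTE ki) => ->; rewrite scale0r.
pose P t := \sum_(j < r.+1) t ^+ j *: c j.
have XP : Xpoly r P by exists c.
exists P; split => // V [d Vd].
have WPg : L1_rep `]a, b[ (fun t => W t - P t) (fun t => g t - P t).
  by apply: L1_repB => //; exact: L1_rep_Xpoly XP.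
rewrite (L1_rep_Rintegral (fun t y => ip y (V t)) WPg).
transitivity (\int[mu]_(t in `]a, b[) (\sum_(i < r.+1) t ^+ i * ip (d i) (g t - P t))).
  apply: eq_Rintegral => t _; rewrite Vd ip_sumr; apply: eq_bigr => i _.
  by rewrite ipZr ipC.
have iW i x : mu.-integrable `]a, b[ (EFin \o fun t => t ^+ i * ip x (g t)).
  have [sg ig _] := L1_rep_expr i Wg.
  have := integrable_ip hX x _ sg ig.
  rewrite (_ : _ \o _ = fun t => (ip x (t ^+ i *: g t))%:E).
    exact.
  by apply/funext => t /=; rewrite ipZr.
have iP i x : mu.-integrable `]a, b[ (EFin \o fun t => t ^+ i * ip x (P t)).
  have [sg ig _] := L1_rep_expr i (L1_rep_Xpoly a b XP).
  have := integrable_ip hX x _ sg ig.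
  rewrite (_ : _ \o _ = fun t => (ip x (t ^+ i *: P t))%:E).
    exact.
  by apply/funext => t /=; rewrite ipZr.
have iB (i : nat) x : mu.-integrable `]a, b[ (EFin \o fun t => t ^+ i * ip x (g t - P t)).
  have := integrableB _ (iW i x) (iP i x).
  rewrite (_ : (fun t => _) = EFin \o fun t => t ^+ i * ip x (g t - P t)).
    exact.
  by apply/funext => t /=; rewrite ipBr mulrBr.
rewrite Rintegral_sum//; apply: big1 => i _.
transitivity (\int[mu]_(t in `]a, b[) (t ^+ i * ip (d i) (g t) - t ^+ i * ip (d i) (P t))).
  by apply: eq_Rintegral => t _; rewrite ipBr mulrBr.
rewrite RintegralB// -mE Rintegral_ip_Xpoly -cE ip_sumr.
apply/eqP; rewrite subr_eq0; apply/eqP; apply: eq_bigr => j _.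
by rewrite ipZr mxE.
Qed.

Lemma L2projP r a b W g : a < b -> L1_rep `]a, b[ W g ->
  is_L2proj ip r a b W (L2proj ip r a b W).
Proof. by move=> ab /(L2proj_exists r ab); exact: xgetPex. Qed.

(** Testing against constants: the projection has the same mean value. *)
Lemma Rintegral_ip_L2proj r a b W g x : a < b -> L1_rep `]a, b[ W g ->
  \int[mu]_(t in `]a, b[) ip x (L2proj ip r a b W t) =
  \int[mu]_(t in `]a, b[) ip x (g t).
Proof.
move=> ab Wg; have [XP PW] := L2projP r ab Wg.
move: (L2proj _ _ _ _ _) XP PW => P XP PW.
have [sg ig _] := Wg; have [sP iP _] := L1_rep_Xpoly a b XP.
have WPg : L1_rep `]a, b[ (fun t => W t - P t) (fun t => g t - P t).
  by apply: L1_repB => //; exact: L1_rep_Xpoly XP.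
apply/esym/eqP; rewrite -subr_eq0 -RintegralB//; try exact: integrable_ip.
rewrite -(PW _ (Xpoly_cst _ x)) (L1_rep_Rintegral (fun t y => ip y x) WPg).
by apply/eqP; apply: eq_Rintegral => t _; rewrite -ipBr ipC.
Qed.

End L2Projection.

(** * Primitives and the reconstruction *)

Section PrimitivePairs.
Context {R : realType} {X : completeNormedModType R}.
Variables (ip : {dot X for (@idfun R)}) (hX : hilbert_norm ip).
Implicit Types (a b : R) (S dS : R -> X).

Local Notation mu := (@lebesgue_measure R).
Local Notation mR := (measurableTypeR R).

(** [dS] is the derivative of [S], both pointwise and in the weak form of the
    fundamental theorem of calculus. *)
Definition C1_pair S dS : Prop :=
  [/\ forall t : R, is_derive t (1 : R) S (dS t),
      forall a b, L1_rep `]a, b[ dS dS &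
      forall a b x, a <= b ->
        \int[mu]_(t in `]a, b[) ip x (dS t) = ip x (S b) - ip x (S a)].

Lemma C1_pair_integrable S dS a b x : C1_pair S dS ->
  mu.-integrable `]a, b[ (fun t => (ip x (dS t))%:E).
Proof. by move=> [_ /(_ a b)[sS iS _] _]; exact: integrable_ip. Qed.

Lemma is_derive_hornerZ (p : {poly R}) (v : X) (t : R) :
  is_derive t (1 : R) (fun s => p.[s] *: v) ((p^`()).[t] *: v).
Proof.
have : h^-1 *: (((fun s => p.[s] *: v) \o shift t) (h *: (1 : R)) - p.[t] *: v)
    @[h --> 0^'] --> (p^`()).[t] *: v.
  have -> : (fun h : R => h^-1 *:
      (((fun s => p.[s] *: v) \o shift t) (h *: (1 : R)) - p.[t] *: v)) =
    (fun h : R => (h^-1 *: ((horner p \o shift t) (h *: (1 : R)) - p.[t])) *: v).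
    by apply/funext => h /=; rewrite -scalerBl scalerA.
  apply: cvgZr_tmp; rewrite derivE derive1E; exact: derivable_horner.
by move=> H; split; [apply/cvg_ex; exists ((p^`()).[t] *: v)|exact: cvg_lim H].
Qed.

Lemma C1_pair_cst x : C1_pair (fun=> x) (fun=> 0).
Proof.
split=> [t|a b|a b y _]; first exact: is_derive_cst.
  by apply: L1_rep_cst => //; exact: lebesgue_measure_itv_lty.
rewrite subrr -[RHS](@Rintegral_set0 _ mR R mu (fun=> 0)).
by rewrite /Rintegral; under eq_integral do rewrite ip0r; rewrite !integral0.
Qed.

Lemma C1_pair_hornerZ (p : {poly R}) v :
  C1_pair (fun t => p.[t] *: v) (fun t => (p^`()).[t] *: v).
Proof.
split=> [t|a b|a b x ab]; first exact: is_derive_hornerZ.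
  apply: (@L1_rep_Xpoly _ _ a b (size p^`())); exists (fun i => (p^`())`_i *: v) => t.
  rewrite (horner_coef_wide _ (leqnSn _)) scaler_suml; apply: eq_bigr => i _.
  by rewrite scalerA mulrC.
under eq_Rintegral do rewrite ipZr mulrC.
rewrite RintegralZl//; last exact: integrable_horner.
by rewrite Rintegral_deriv// !ipZr; ring.
Qed.

Lemma C1_pairD S dS S' dS' : C1_pair S dS -> C1_pair S' dS' ->
  C1_pair (fun t => S t + S' t) (fun t => dS t + dS' t).
Proof.
move=> C C'; have [dS1 lS fS] := C; have [dS1' lS' fS'] := C'.
split=> [t|a b|a b x ab]; first exact: is_deriveD.
  by apply: L1_repD.
under eq_Rintegral do rewrite ipDr.
rewrite RintegralD//; [|exact: C1_pair_integrable..].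
by rewrite fS// fS'// !ipDr; ring.
Qed.

Lemma C1_pair_sum n (F G : 'I_n -> R -> X) : (forall i, C1_pair (F i) (G i)) ->
  C1_pair (fun t => \sum_(i < n) F i t) (fun t => \sum_(i < n) G i t).
Proof.
elim: n F G => [|n IH] F G FG.
  rewrite (_ : (fun t => _) = fun=> 0); last by apply/funext => t; rewrite big_ord0.
  rewrite (_ : (fun t : R => \sum_(i < 0) G i t) = fun=> 0); last first.
    by apply/funext => t; rewrite big_ord0.
  exact: C1_pair_cst.
rewrite (_ : (fun t => _) =
  fun t => \sum_(i < n) F (widen_ord (leqnSn n) i) t + F ord_max t).
  rewrite (_ : (fun t => \sum_(i < n.+1) G i t) =
    fun t => \sum_(i < n) G (widen_ord (leqnSn n) i) t + G ord_max t).
    by apply: C1_pairD => //; exact: IH.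
  by apply/funext => t; rewrite big_ord_recr.
by apply/funext => t; rewrite big_ord_recr.
Qed.

Lemma Xpoly_C1_pair r P : Xpoly r P -> exists dP, C1_pair P dP.
Proof.
move=> [c Pc]; exists (fun t => \sum_(i < r.+1) (('X^i)^`()).[t] *: c i).
rewrite (_ : P = fun t => \sum_(i < r.+1) ('X^i).[t] *: c i).
  by apply: C1_pair_sum => i; exact: C1_pair_hornerZ.
by apply/funext => t; rewrite Pc; apply: eq_bigr => i _; rewrite hornerXn.
Qed.

Lemma Xpoly_primitive r P : Xpoly r P -> exists A, C1_pair A P.
Proof.
move=> [c Pc]; exists (fun t => \sum_(i < r.+1) (primitive 'X^i).[t] *: c i).
rewrite (_ : P = fun t => \sum_(i < r.+1) ((primitive 'X^i)^`()).[t] *: c i).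
  by apply: C1_pair_sum => i; exact: C1_pair_hornerZ.
by apply/funext => t; rewrite Pc; apply: eq_bigr => i _; rewrite deriv_primitive hornerXn.
Qed.

Lemma derive1_eq_on S dS (V : R -> X) a b t : C1_pair S dS ->
  (forall s, a < s < b -> V s = S s) -> a < t < b -> derive1 V t = dS t.
Proof.
move=> [dS1 _ _] VS /andP[at_ tb]; rewrite derive1E.
rewrite -(@derive_val _ _ _ _ _ _ _ (dS1 t)).
apply: near_eq_derive; near=> s; apply: VS; apply/andP; split.
  by near: s; exact: lt_nbhsr.
by near: s; exact: lt_nbhsl.
Unshelve. all: by end_near. Qed.

End PrimitivePairs.

Section Reconstruction.
Context {R : realType} {X : completeNormedModType R}.
Variables (ip : {dot X for (@idfun R)}) (hX : hilbert_norm ip).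
Variables (F : R -> X -> X) (tn : nat -> R) (r : nat -> nat) (U : R -> X) (m : nat).

Local Notation mu := (@lebesgue_measure R).
Local Notation a := (tn m.-1).
Local Notation b := (tn m).
Local Notation PiU := (L2proj ip (r m).-1 a b U).

Hypothesis ab : a < b.
Variables g1 g : R -> X.
Hypothesis FPiU_rep : L1_rep `]a, b[ (superpos F PiU) g1.
Hypothesis FU_rep : L1_rep `]a, b[ (superpos F U) g.

(** Up to a constant, a piece is a primitive of the projection plus a real
    primitive of the lifting polynomial times the defect. *)
Lemma recon_piece_C1 : exists S dS, C1_pair ip S dS /\
  forall t, a <= t <= b -> recon_piece ip F tn r U m t = S t.
Proof.
have [XP _] := L2projP hX (r m) ab FU_rep.
rewrite /recon_piece; set delta := recon_defect _ _ _ _ _ _.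
move: (L2proj _ _ _ _ _) XP => P XP.
have [A CA] := Xpoly_primitive hX XP.
set l := primitive (lift_poly (r m) a b).
exists (fun t => (U a - A a - l.[a] *: delta + A t) + l.[t] *: delta).
exists (fun t => (0 + P t) + (lift_poly (r m) a b).[t] *: delta); split.
  apply: C1_pairD => //; first by apply: C1_pairD => //; exact: C1_pair_cst.
  by have := C1_pair_hornerZ ip l delta; rewrite deriv_primitive.
move=> t /andP[at_ _].
have -> : bochner_integral `]a, t[ P = A t - A a.
  apply: (ip_eq hX) => z.
  have [_ _ FA] := CA.
  rewrite (bochner_integral_ip hX _ _ (L1_rep_Xpoly a t XP))// ?lebesgue_measure_itv_lty//.
  by rewrite FA// ipBr.
have -> : \int[mu]_(s in `]a, t[) (lift_poly (r m) a b).[s] = l.[t] - l.[a].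
  by rewrite -Rintegral_deriv// deriv_primitive.
rewrite scalerBl -!addrA; congr (_ + _); rewrite addrCA; congr (_ + _).
by rewrite addrA addrC [RHS]addrAC; congr (_ + _); exact: addrC.
Qed.

Lemma recon_piece_left : recon_piece ip F tn r U m a = U a.
Proof.
have [XP _] := L2projP hX (r m) ab FU_rep.
rewrite /recon_piece set_itvoo0 Rintegral_set0 scale0r addr0.
suff -> : bochner_integral set0 (L2proj ip (r m) a b (superpos F U)) = 0 by rewrite addr0.
apply: (ip_eq hX) => z; have := L1_rep_Xpoly a a XP; rewrite set_itvoo0 => rep.
by rewrite (bochner_integral_ip hX _ _ rep)// ?measure0// Rintegral_set0 ip0r.
Qed.

(** The Galerkin equation, tested against constants, together with the mean
    values of the two projections and of the lifting polynomial. *)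
Lemma recon_piece_right P : Xpoly (r m) P ->
  (forall t, a <= t <= b -> U t = P t) ->
  (forall V : R -> X, Xpoly (r m).-1 V ->
     \int[mu]_(t in `]a, b[) ip (derive1 U t - superpos F PiU t) (V t) = 0) ->
  recon_piece ip F tn r U m b = U b.
Proof.
move=> XP UP gal; have [dP CP] := Xpoly_C1_pair hX XP.
have [_ LdP FP] := CP.
have Doo := lebesgue_measure_itv_lty a b.
apply: (ip_eq hX) => z; rewrite /recon_piece Rintegral_lift_poly// scale1r !ipDr.
have [XQ _] := L2projP hX (r m) ab FU_rep.
rewrite (bochner_integral_ip hX _ Doo (L1_rep_Xpoly a b XQ))//.
rewrite (Rintegral_ip_L2proj hX _ _ ab FU_rep).
have D_rep := L1_repB (measurable_itv _) FPiU_rep FU_rep.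
have [XD _] := L2projP hX (r m).-1 ab D_rep.
rewrite /recon_defect (bochner_integral_ip hX _ Doo (L1_rep_Xpoly a b XD))//.
rewrite (Rintegral_ip_L2proj hX _ _ ab D_rep).
have [sg1 ig1 _] := FPiU_rep; have [sg ig _] := FU_rep.
have -> : \int[mu]_(t in `]a, b[) ip z (g1 t - g t) =
    \int[mu]_(t in `]a, b[) ip z (g1 t) - \int[mu]_(t in `]a, b[) ip z (g t).
  rewrite -RintegralB//; try exact: (integrable_ip hX).
  by apply: eq_Rintegral => t _; rewrite ipBr.
have gz : \int[mu]_(t in `]a, b[) ip z (dP t) = \int[mu]_(t in `]a, b[) ip z (g1 t).
  apply/eqP; rewrite -subr_eq0 -RintegralB//; last 2 first.
  - exact: (C1_pair_integrable hX a b z CP).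
  - exact: (integrable_ip hX).
  rewrite -(gal _ (Xpoly_cst _ z)) -(L1_rep_Rintegral (fun t y => ip z (dP t) - ip z y) FPiU_rep).
  apply/eqP; apply: eq_Rintegral => t; rewrite inE/= in_itv/= => tab.
  have UP' s : a < s < b -> U s = P s by move=> /andP[as_ sb]; rewrite UP// !ltW.
  by rewrite (derive1_eq_on CP UP' tab) [RHS]ipC ipBr.
rewrite -gz FP ?ltW// -!UP ?lexx ?ltW//; ring.
Qed.

End Reconstruction.

(** * Growth of the norm under dissipation *)

Section SmoothNorm.
Context {R : realType} {X : completeNormedModType R}.
Variables (ip : {dot X for (@idfun R)}) (hX : hilbert_norm ip).
Variables (eps : R) (eps0 : 0 < eps).
Implicit Types (x y : X).

(** A convex approximation of the norm, with a Lipschitz gradient. *)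
Definition smooth_norm x := Num.sqrt (eps ^+ 2 + `|x| ^+ 2).

Lemma smooth_norm_sqr x : smooth_norm x ^+ 2 = eps ^+ 2 + `|x| ^+ 2.
Proof. by rewrite sqr_sqrtr// addr_ge0// exprn_ge0// ltW. Qed.

Lemma smooth_norm_gt0 x : 0 < smooth_norm x.
Proof. by rewrite sqrtr_gt0 ltr_pwDl// ?exprn_gt0// exprn_ge0. Qed.

Lemma norm_le_smooth x : `|x| <= smooth_norm x.
Proof.
rewrite -(ler_pXn2r (n := 2))// ?nnegrE// ?sqrtr_ge0// smooth_norm_sqr.
by rewrite lerDr exprn_ge0// ltW.
Qed.

Lemma eps_le_smooth x : eps <= smooth_norm x.
Proof.
rewrite -(ler_pXn2r (n := 2))// ?nnegrE ?sqrtr_ge0 ?(ltW eps0)// smooth_norm_sqr.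
by rewrite lerDl exprn_ge0.
Qed.

Lemma smooth_norm_le x : smooth_norm x <= eps + `|x|.
Proof.
have ge : 0 <= eps + `|x| by rewrite addr_ge0// ltW.
rewrite -(ler_pXn2r (n := 2))// ?nnegrE// ?sqrtr_ge0// smooth_norm_sqr.
have := mulr_ge0 (ltW eps0) (normr_ge0 x); rewrite sqrrD; lra.
Qed.

(** Convexity: [smooth_norm] lies above its tangent at [x], whose slope is
    [x / smooth_norm x]. *)
Lemma smooth_norm_convex x y :
  smooth_norm x - smooth_norm y <= ip ((smooth_norm x)^-1 *: x) (x - y).
Proof.
have px := smooth_norm_gt0 x; have py := smooth_norm_gt0 y.
rewrite (ipZl ip) ipBr -hX mulrC ler_pdivlMr// mulrC mulrBr -expr2 smooth_norm_sqr.
have : eps ^+ 2 + `|x| * `|y| <= smooth_norm x * smooth_norm y.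
  rewrite -(ler_pXn2r (n := 2))// ?nnegrE
    ?mulr_ge0 ?addr_ge0 ?exprn_ge0 ?mulr_ge0 ?(ltW eps0) ?(ltW px) ?(ltW py)//.
  rewrite exprMn !smooth_norm_sqr.
  have := mulr_ge0 (exprn_ge0 2 (ltW eps0)) (sqr_ge0 (`|x| - `|y|)).
  by rewrite sqrrB sqrrD; nra.
have := ip_le_norm hX x y; lra.
Qed.

Lemma smooth_norm_lip x y : `|smooth_norm x - smooth_norm y| <= `|x - y|.
Proof.
have half z w : smooth_norm z - smooth_norm w <= `|z - w|.
  apply: le_trans (smooth_norm_convex z w) _.
  apply: le_trans (ip_le_norm hX _ _) _.
  rewrite ler_piMl// normrZ gtr0_norm ?invr_gt0 ?smooth_norm_gt0// mulrC.
  by rewrite ler_pdivrMr ?smooth_norm_gt0// mul1r norm_le_smooth.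
by rewrite ler_norml half andbT lerNl opprB distrC half.
Qed.

Lemma smooth_gradient_lip x y :
  `|(smooth_norm x)^-1 *: x - (smooth_norm y)^-1 *: y| <= 2 / eps * `|x - y|.
Proof.
have px := smooth_norm_gt0 x; have py := smooth_norm_gt0 y.
have -> : (smooth_norm x)^-1 *: x - (smooth_norm y)^-1 *: y =
    (smooth_norm x)^-1 *: (x - y) + ((smooth_norm x)^-1 - (smooth_norm y)^-1) *: y.
  by rewrite scalerBr scalerBl addrA subrK.
have iex : (smooth_norm x)^-1 <= eps^-1 by rewrite lef_pV2 ?posrE// eps_le_smooth.
have ix0 : 0 < (smooth_norm x)^-1 by rewrite invr_gt0.
rewrite (le_trans (ler_normD _ _))// !normrZ mulrDl mulrDl mul1r lerD//.
  by rewrite gtr0_norm// ler_wpM2r.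
have -> : (smooth_norm x)^-1 - (smooth_norm y)^-1 =
   (smooth_norm x)^-1 * ((smooth_norm y - smooth_norm x) * (smooth_norm y)^-1).
  by field; rewrite !gt_eqF.
rewrite normrM [`|(smooth_norm x)^-1|]gtr0_norm// -mulrA.
apply: ler_pM => //; first exact: ltW.
rewrite normrM [`|(smooth_norm y)^-1|]gtr0_norm ?invr_gt0// -mulrA.
rewrite [`|x - y|]distrC; apply: le_trans (smooth_norm_lip y x).
by apply: ler_piMr => //; rewrite mulrC ler_pdivrMr// mul1r norm_le_smooth.
Qed.

End SmoothNorm.

Section Energy.
Context {R : realType} {X : completeNormedModType R}.
Variables (ip : {dot X for (@idfun R)}) (hX : hilbert_norm ip).

Local Notation mu := (@lebesgue_measure R).
Local Notation mR := (measurableTypeR R).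

Lemma integrable_sub_oo (f : R -> R) (a b s s' : R) :
  mu.-integrable `]a, b[ (EFin \o f) -> a <= s -> s' <= b ->
  mu.-integrable `]s, s'[ (EFin \o f).
Proof.
move=> fi as_ sb; apply: (@integrableS _ mR R mu `]a, b[%classic) => //.
by apply: subset_itvW.
Qed.

Lemma Rintegral_oo_split (f : R -> R) (a s b : R) : a <= s -> s <= b ->
  mu.-integrable `]a, b[ (EFin \o f) ->
  \int[mu]_(t in `]a, b[) f t =
  \int[mu]_(t in `]a, s[) f t + \int[mu]_(t in `]s, b[) f t.
Proof.
move=> as_; rewrite le_eqVlt => /predU1P[->|sb] fi.
  by rewrite set_itvoo0 Rintegral_set0 addr0.
have := @Rintegral_itvB R f (BRight a) (BLeft b) s fi.
rewrite !bnd_simp => /(_ as_ sb) <-.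
rewrite -Rintegral_itv_bndo_bndc; first by rewrite addrC subrK.
apply: (@integrableS _ mR R mu `]a, b[%classic) => //.
by apply: subset_itvl; rewrite bnd_simp ltW.
Qed.

(** Absolute continuity of the integral, for intervals. *)
Lemma integrable_small_intervals (f : R -> R) (a b eta : R) :
  mu.-integrable `]a, b[ (EFin \o f) -> 0 < eta ->
  exists2 d, 0 < d & forall s s', a <= s -> s <= s' -> s' <= b -> s' - s < d ->
    \int[mu]_(t in `]s, s'[) `|f t| < eta.
Proof.
move=> fi eta0.
have fiT : mu.-integrable [set: mR] (EFin \o (f \_ `]a, b[%classic)).
  by rewrite -restrict_EFin; apply/integrable_restrict => //=; rewrite setTI.
have [d [d0 dP]] := integral_normr_continuous fiT eta0.
exists d => // s s' as_ ss' sb sd.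
have sm : (mu `]s, s'[ < d%:E)%E.
  by rewrite lebesgue_measure_itv/=; case: ifPn => _; rewrite -?EFinB lte_fin.
have := dP `]s, s'[%classic (measurable_itv _) sm.
have -> : \int[mu]_(x in `]s, s'[) `|(f \_ `]a, b[%classic) x| =
   \int[mu]_(x in `]s, s'[) `|f x|.
  apply: eq_Rintegral => t; rewrite inE/= in_itv/= => /andP[st ts'].
  rewrite patchE mem_set//= in_itv/=.
  by rewrite (le_lt_trans as_ st) (lt_le_trans ts' sb).
by [].
Qed.

Section Estimate.
Variables (e g : R -> X) (rho : R -> R) (a b : R).
Hypothesis ab : a <= b.
Hypothesis sg : simple_limit g.
Hypothesis ig : mu.-integrable `]a, b[ (fun t => `|g t|%:E).
Hypothesis irho : mu.-integrable `]a, b[ (EFin \o rho).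
Hypothesis rho0 : forall t, 0 <= rho t.
Hypothesis e_primitive : forall x s s', a <= s -> s <= s' -> s' <= b ->
  ip x (e s') - ip x (e s) = \int[mu]_(t in `]s, s'[) ip x (g t).
Hypothesis dissip : forall t, a < t < b -> ip (e t) (g t) <= `|e t| * rho t.

Let e_dist s s' : a <= s -> s <= s' -> s' <= b ->
  `|e s' - e s| <= \int[mu]_(t in `]s, s'[) `|g t|.
Proof.
move=> as_ ss' sb; apply: (norm_le_dual hX); first exact: Rintegral_ge0.
move=> z; rewrite ipBr e_primitive//; apply: (Rintegral_ip_le hX) => //.
exact: (integrable_sub_oo (f := fun t => `|g t|) ig).
Qed.

Let integrable_rate eps :
  mu.-integrable `]a, b[ (EFin \o fun t => rho t + eps * `|g t|).
Proof.
have mab : measurable (`]a, b[%classic : set mR) by exact: measurable_itv.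
have := integrableD mab irho (integrableZl mab eps ig).
exact.
Qed.

(** On short intervals the increment of the smoothed norm is bounded by
    convexity, and the gradient at the right endpoint may be replaced by the
    gradient at [t] up to [eps]. *)
Let smooth_step eps : 0 < eps -> exists2 d, 0 < d &
  forall s s', a <= s -> s <= s' -> s' <= b -> s' - s < d ->
  smooth_norm eps (e s') - smooth_norm eps (e s) <=
    \int[mu]_(t in `]s, s'[) (rho t + eps * `|g t|).
Proof.
move=> eps0; have eta0 : 0 < eps * eps / 2 by rewrite divr_gt0// mulr_gt0.
have [d d0 dP] := integrable_small_intervals (f := fun t => `|g t|) ig eta0.
exists d => // s s' as_ ss' sb sd.
apply: le_trans (smooth_norm_convex hX eps0 _ _) _; rewrite ipBr e_primitive//.
have igs : mu.-integrable `]s, s'[ (fun t => `|g t|%:E).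
  exact: (integrable_sub_oo (f := fun t => `|g t|) ig).
apply: le_Rintegral => //.
- exact: (integrable_ip hX).
- exact: (integrable_sub_oo (integrable_rate eps)).
move=> t /=; rewrite in_itv/= => /andP[st ts'].
have gt0 := smooth_norm_gt0 eps0 (e t).
rewrite -[in leLHS](subrK ((smooth_norm eps (e t))^-1 *: e t)
  ((smooth_norm eps (e s'))^-1 *: e s')) ipDl addrC lerD//.
  rewrite ipZl; apply: (@le_trans _ _ ((smooth_norm eps (e t))^-1 * (`|e t| * rho t))).
    rewrite ler_pM2l ?invr_gt0// dissip// (le_lt_trans as_ st)/=.
    exact: lt_le_trans ts' sb.
  by rewrite mulrA ler_piMl// mulrC ler_pdivrMr// mul1r norm_le_smooth.
apply: le_trans (ip_le_norm hX _ _) _; rewrite ler_wpM2r//.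
apply: le_trans (smooth_gradient_lip hX eps0 _ _) _.
rewrite -ler_pdivlMl ?divr_gt0// invf_div.
have -> : eps / 2 * eps = eps * eps / 2 by ring.
apply: le_trans (e_dist _ _ _) _; rewrite ?(le_trans as_)// ltW//.
have := dP t s'; under eq_Rintegral do rewrite normr_id.
apply; rewrite ?(le_trans as_)// ?ltW//.
by apply: le_lt_trans sd; rewrite lerD2l lerN2 ltW.
Qed.

Let smooth_bound eps s : 0 < eps -> a <= s -> s <= b ->
  smooth_norm eps (e s) <= smooth_norm eps (e a) +
    \int[mu]_(t in `]a, s[) (rho t + eps * `|g t|).
Proof.
move=> eps0; have [d d0 dP] := smooth_step eps0.
pose K t := rho t + eps * `|g t|.
have iK : mu.-integrable `]a, b[ (EFin \o K) by exact: integrable_rate.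
have K0 t : 0 <= K t by rewrite addr_ge0// mulr_ge0// ltW.
have h0 : 0 < d / 2 by rewrite divr_gt0.
suff H n : forall s, a <= s -> s <= b -> s - a <= (d / 2) *+ n ->
    smooth_norm eps (e s) <= smooth_norm eps (e a) + \int[mu]_(t in `]a, s[) K t.
  move=> as_ sb; apply: (H (Num.bound ((s - a) / (d / 2)))) => //.
  rewrite -mulr_natl -ler_pdivrMr//; apply: ltW; apply: le_lt_trans (archi_boundP _).
    by [].
  by rewrite divr_ge0 ?subr_ge0// ltW.
(* Steps of half the admissible length keep the last one below [d]. *)
elim: n => [|n IH] {}s as_ sb.
  rewrite mulr0n subr_le0 => sa; have -> : s = a by apply/le_anti/andP.
  by rewrite lerDl Rintegral_ge0.
rewrite mulrSr => sn.
pose s0 := Num.max a (s - d / 2).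
have as0 : a <= s0 by rewrite le_max lexx.
have s0s : s0 <= s by rewrite ge_max as_ lerBlDr lerDl ltW.
have s0b := le_trans s0s sb.
have s0n : s0 - a <= (d / 2) *+ n.
  rewrite lerBlDr ge_max; apply/andP; split; last by lra.
  by rewrite lerDr mulrn_wge0// ltW.
have := IH _ as0 s0b s0n.
have sd : s - s0 < d.
  have : s - d / 2 <= s0 by rewrite le_max lexx orbT.
  lra.
have := dP _ _ as0 s0s sb sd.
rewrite (Rintegral_oo_split as0 s0s); last exact: (integrable_sub_oo iK).
rewrite -/K; lra.
Qed.

(** The integrated form of [|e|' <= rho], obtained from [smooth_bound] in the
    limit [eps -> 0]. *)
Lemma norm_growth : `|e b| <= `|e a| + \int[mu]_(t in `]a, b[) rho t.
Proof.
set I := \int[mu]_(t in `]a, b[) rho t.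
set J := \int[mu]_(t in `]a, b[) `|g t|.
have J0 : 0 <= J by exact: Rintegral_ge0.
apply/ler_addgt0Pr => h h0.
(* The bound exceeds the claim by [eps + eps * J], where [J] is the
   integral of [|g|]. *)
have eps0 : 0 < h / (1 + J) by rewrite divr_gt0// ltr_pwDl.
set eps := h / (1 + J) in eps0.
have epsE : eps * (1 + J) = h by rewrite divfK// gt_eqF// ltr_pwDl.
apply: le_trans (norm_le_smooth eps0 _) _.
apply: le_trans (smooth_bound eps0 ab (lexx b)) _.
have := smooth_norm_le eps0 (e a).
have mab : measurable (`]a, b[%classic : set mR) by exact: measurable_itv.
rewrite RintegralD//; last by have := integrableZl mab eps ig; exact.
rewrite RintegralZl// -/I -/J -epsE; lra.
Qed.

End Estimate.

End Energy.

(** * The error on one time step *)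

Section Partition.
Context {R : realType}.
Variables (T : R) (M : nat) (tn : nat -> R).
Hypothesis htn : is_partition T M tn.

Lemma partition_le i j : (i <= j)%N -> (j <= M)%N -> tn i <= tn j.
Proof.
have [_ _ lt_tn] := htn; elim: j => [|j IH].
  by rewrite leqn0 => /eqP ->.
rewrite leq_eqVlt => /predU1P[->//|ij] jM.
by apply: le_trans (ltW (lt_tn j jM)); apply: IH => //; exact: ltnW.
Qed.

Lemma partition_cover s : 0 < T -> 0 <= s <= T ->
  exists m : 'I_M, tn m <= s <= tn m.+1.
Proof.
have [t0 tM lt_tn] := htn; move=> T0 /andP[s0 sT]; apply/not_existsP => no.
have H k : (k <= M)%N -> tn k <= s /\ ((0 < k)%N -> tn k < s).
  elim: k => [|k IH] kM; first by rewrite t0.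
  have [ks _] := IH (ltnW kM); have := no (Ordinal kM); rewrite /= ks /= => /negP.
  by rewrite -ltNge => lt; split=> //; exact: ltW.
have [_] := H M (leqnn _); rewrite tM; have [M0|_ /(_ isT)] := posnP M.
  by move: tM T0; rewrite M0 t0 => ->; rewrite ltxx.
by rewrite ltNge sT.
Qed.

Lemma partition_inj i j t : (i < M)%N -> (j < M)%N ->
  tn i < t < tn i.+1 -> tn j <= t <= tn j.+1 -> i = j.
Proof.
move=> iM jM /andP[it ti] /andP[jt tj]; apply/eqP; rewrite eqn_leq; apply/andP; split.
  rewrite leqNgt; apply/negP => ji.
  by have := partition_le ji (ltnW iM); rewrite leNgt (lt_le_trans it tj).
rewrite leqNgt; apply/negP => ij.
by have := partition_le ij (ltnW jM); rewrite leNgt (le_lt_trans jt ti).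
Qed.

End Partition.

Section ExactSolution.
Context {R : realType} {X : completeNormedModType R}.
Variables (ip : {dot X for (@idfun R)}) (hX : hilbert_norm ip).

Local Notation mu := (@lebesgue_measure R).
Local Notation mR := (measurableTypeR R).

Lemma time_derivative_increment (T : R) (u du g : R -> X) :
  is_time_derivative T u du -> L1_rep `]0, T[ du g ->
  forall x s s', 0 <= s -> s <= s' -> s' <= T ->
    ip x (u s') - ip x (u s) = \int[mu]_(t in `]s, s'[) ip x (g t).
Proof.
move=> [_ uE] rep x.
have rep_ t : t <= T -> L1_rep `]0, t[ du g.
  by move=> tT; apply: L1_repS rep => //; apply: subset_itvW.
have ux t : 0 <= t <= T ->
    ip x (u t) = ip x (u 0) + \int[mu]_(s in `]0, t[) ip x (g s).
  move=> /andP[t0 tT]; rewrite uE ?t0// ipDr; congr (_ + _).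
  by rewrite (bochner_integral_ip hX _ _ (rep_ _ tT))//; exact: lebesgue_measure_itv_lty.
move=> s s' s0 ss' sT; 
have hs : 0 <= s <= T by rewrite s0 (le_trans ss').
have hs' : 0 <= s' <= T by rewrite sT (le_trans s0).
rewrite (ux _ hs) (ux _ hs').
rewrite [X in _ + X - _](Rintegral_oo_split s0 ss'); first by ring.
have [sg ig _] := rep_ _ sT; exact: (integrable_ip hX).
Qed.

End ExactSolution.

Section StepEstimate.
Context {R : realType} {X : completeNormedModType R}.
Variables (ip : {dot X for (@idfun R)}) (hX : hilbert_norm ip).
Variables (T : R) (F : R -> X -> X).
Hypothesis F_orth : forall t, 0 < t <= T -> forall v : X, ip (F t v) v = 0.
Hypothesis F_skew : forall t, 0 < t <= T ->
  forall v w : X, ip (F t v) w >= - ip v (F t w).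
Variables (u0 : X) (u : R -> X).
Hypothesis hu : exact_solution F T u0 u.

Local Notation mu := (@lebesgue_measure R).
Local Notation mR := (measurableTypeR R).

(** By skewness [<F v, w> + <v, F w> >= 0], and by orthogonality this is
    [- <v - w, F v - F w>]; only the residual [F w - z] remains. *)
Lemma dissipative t v w z : 0 < t <= T ->
  ip (v - w) (F t v - z) <= `|v - w| * `|F t w - z|.
Proof.
move=> tT; apply: le_trans (ip_le_norm hX (v - w) (F t w - z)).
rewrite !ipBr lerB// !ipBl.
have := F_skew tT v w; have := F_orth tT v; have := F_orth tT w.
rewrite !(ipC ip (F t _)); lra.
Qed.

(** [norm_growth] for Borel representatives of [u' - Q'] and of the residual.
    If the integral of the residual is infinite there is nothing to prove. *)
Lemma step_estimate (a b : R) (V Q dQ : R -> X) :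
  0 <= a -> b <= T -> C1_pair ip Q dQ -> (forall t, a < t < b -> V t = Q t) ->
  strongly_measurable `]0, T[ (superpos F V) ->
  forall s, a <= s -> s <= b ->
  (`|u s - Q s|%:E <= `|u a - Q a|%:E +
     \int[mu]_(t in `]a, s[) `|superpos F V t - derive1 V t|%:E)%E.
Proof.
move=> a0 bT CQ VQ mFV s as_ sb; set I := (\int[mu]_(t in _) _)%E.
have I0 : (0 <= I)%E by exact: integral_ge0.
have [->|Ioo] := eqVneq I +oo%E; first by rewrite addey// leey.
have sT := le_trans sb bT.
have [_ [du [L1du uE] duF]] := hu.
have mT : measurable (`]0, T[%classic : set mR) by exact: measurable_itv.
have [gu rep] := L1_rep_LpX1 mT L1du.
have [sgu igu [Nu [mNu Nu0 guE]]] := rep.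
have [k [Nk [mNk Nk0 sk kE]]] := strongly_measurable_rep mT mFV.
have [dQ1 LdQ FQ] := CQ.
have mS : measurable (`]a, s[%classic : set mR) by exact: measurable_itv.
have sub_T : `]a, s[%classic `<=` `]0, T[%classic by apply: subset_itvW.
pose N := Nu `|` Nk.
have mN : measurable N by exact: measurableU.
have N0 : mu N = 0%E by rewrite measureU0.
have mCN : measurable (~` N : set mR) by exact: measurableC.
have offN t : a < t < s -> ~ N t ->
    [/\ gu t = F t (u t), k t = F t (Q t) & superpos F V t - derive1 V t = k t - dQ t].
  move=> /andP[at_ ts] /not_orP[nu nk].
  have tT : 0 < t < T by rewrite (le_lt_trans a0 at_) (lt_le_trans ts sT).
  have tab : a < t < b by rewrite at_ (lt_le_trans ts sb).
  have inT : `]0, T[%classic t by rewrite /= in_itv.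
  have kt : k t = F t (Q t).
    by rewrite kE; case: asboolP => [_|[]//]; rewrite /superpos VQ.
  split=> //.
    by rewrite -guE// duF//; move: tT => /andP[-> /ltW].
  by rewrite kt /superpos VQ// (derive1_eq_on CQ VQ tab).
(* Both functions are set to zero on the exceptional null set, where the
   differential equation is not available. *)
pose g t := \1_(~` N) t *: (gu t - dQ t).
pose rho t := `|\1_(~` N) t *: (k t - dQ t)|.
have sdQ : simple_limit dQ by have [] := LdQ a b.
have mI : measurable_fun [set: mR] (\1_(~` N) : R -> R) by exact: measurable_indic.
have sg : simple_limit g by apply: simple_limitZ => //; exact: simple_limitB.
have srho : simple_limit (fun t => \1_(~` N) t *: (k t - dQ t)).
  by apply: simple_limitZ => //; exact: simple_limitB.
have irho_eq : I = (\int[mu]_(t in `]a, s[) (rho t)%:E)%E.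
  apply: (integral_off_null mN N0) => t; rewrite /= in_itv/= => ts Nt.
  have [_ _ ->] := offN t ts Nt.
  by rewrite /rho indicE mem_set// scale1r.
have irho : mu.-integrable `]a, s[ (EFin \o rho).
  apply/integrableP; split.
    by apply/measurable_EFinP/measurable_funTS; exact: simple_limit_norm srho.
  under eq_integral do rewrite /= normr_id.
  by rewrite -irho_eq ltey.
have ig : mu.-integrable `]a, s[ (fun t => `|g t|%:E).
  have [_ igd _] := L1_repB mS (L1_repS mT mS sub_T rep) (LdQ a s).
  apply: (le_integrable mS _ _ igd).
    by apply/measurable_EFinP/measurable_funTS; exact: simple_limit_norm.
  move=> t _ /=; rewrite lee_fin !normr_id normrZ ler_piMl//.
  by rewrite indicE; case: (_ \in _); rewrite ?normr1 ?normr0.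
have growth : `|u s - Q s| <= `|u a - Q a| + \int[mu]_(t in `]a, s[) rho t.
  apply: (norm_growth hX (e := fun t => u t - Q t) as_ sg ig irho) => //.
  - by move=> t; exact: normr_ge0.
  - move=> x t t' at_ tt' ts.
    have u_inc := time_derivative_increment hX (conj L1du uE) rep x
      (le_trans a0 at_) tt' (le_trans ts sT).
    transitivity (\int[mu]_(r in `]t, t'[) (ip x (gu r) - ip x (dQ r))).
      have Dt : `]t, t'[%classic `<=` `]a, s[%classic by apply: subset_itvW.
      have mt : measurable (`]t, t'[%classic : set mR) by exact: measurable_itv.
      have [_ igt _] := L1_repS mS mt Dt (L1_repS mT mS sub_T rep).
      rewrite RintegralB//; last 2 first.
        exact: (integrable_ip hX).
        exact: (C1_pair_integrable hX t t' x CQ).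
      by rewrite -u_inc FQ// !ipBr; ring.
    apply: (Rintegral_off_null mN N0) => r _ Nr.
    by rewrite /g indicE mem_set// scale1r ipBr.
  - move=> t ats; rewrite /g /rho indicE; case: (boolP (t \in _)) => [|_]; last first.
      by rewrite scale0r ip0r scale0r normr0 mulr0.
    rewrite inE => Nt; rewrite !scale1r; have [-> -> _] := offN t ats Nt.
    apply: dissipative; move: ats => /andP[at_ ts].
    by rewrite (le_lt_trans a0 at_) ltW// (lt_le_trans ts sT).
have -> : I = (\int[mu]_(t in `]a, s[) rho t)%:E.
  by rewrite irho_eq /Rintegral fineK// -irho_eq ge0_fin_numE// ltey.
by rewrite -EFinD lee_fin.
Qed.

End StepEstimate.

(** * The a posteriori bound *)

Section EssentialSupremum.
Context {R : realType} {X : completeNormedModType R}.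

Local Notation mu := (@lebesgue_measure R).

(** An additive constant comes out of the norm even though the extension by
    zero does not see it outside [D]: the right-hand side is nonnegative. *)
Lemma LpX_normy_le (D : set R) (f h : R -> X) (c : \bar R) : (0 <= c)%E ->
  (forall t, D t -> (`|f t|%:E <= c + `|h t|%:E)%E) ->
  (LpX_norm +oo D f <= c + LpX_norm +oo D h)%E.
Proof.
move=> c0 fh; rewrite /LpX_norm unlock; case: ifPn => _; last by rewrite adde0.
apply/ess_supP.
have := ess_sup_ge mu (abse \o ((fun t => `|h t|%:E) \_ D)).
apply: filterS => t /= ht; apply: le_trans (leeD2l c ht).
rewrite !patchE; case: ifPn => [|_]; last by rewrite abse0 adde0.
by rewrite inE => Dt; rewrite /= !normr_id; exact: fh.
Qed.

End EssentialSupremum.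

Theorem theorem1 (R : realType) (X : completeNormedModType R)
    (ip : {dot X for (@idfun R)}) (hX : hilbert_norm ip)
    (T : R) (hT : 0 < T) (u0 : X) (F : R -> X -> X)
    (F_orth : forall t, 0 < t <= T -> forall v : X, ip (F t v) v = 0)
    (F_skew : forall t, 0 < t <= T ->
       forall v w : X, ip (F t v) w >= - ip v (F t w))
    (u : R -> X) (hu : exact_solution F T u0 u)
    (M : nat) (tn : nat -> R) (htn : is_partition T M tn)
    (r : nat -> nat) (hr : forall m, (1 <= m <= M)%N -> (1 <= r m)%N)
    (U : R -> X) (hU : cG_solution ip F T u0 M tn r U)
    (FPiU_L2 : forall m, (1 <= m <= M)%N ->
       LpX 2%:E `]tn m.-1, tn m[
         (superpos F (L2proj ip (r m).-1 (tn m.-1) (tn m) U)))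
    (FU_L2 : forall m, (1 <= m <= M)%N ->
       LpX 2%:E `]tn m.-1, tn m[ (superpos F U)) :
  let Uh := reconstruction ip F M tn r U in
  strongly_measurable `]0, T[ (superpos F Uh) ->
  forall t, 0 <= t <= T ->
    (LpX_norm +oo `]0%R, t[ (fun s => u s - U s)%R
     <= LpX_norm 1 `]0%R, t[ (fun s => superpos F Uh s - derive1 Uh s)%R
        + LpX_norm +oo `]0%R, t[ (fun s => U s - Uh s)%R)%E.
Proof.
move=> Uh mFUh t /andP[t0 tT]; have [tn0 tnM lt_tn] := htn.
have [_ U_poly U0 galerkin] := hU.
pose G (s : R) : \bar R := (\int[@lebesgue_measure R]_(x in `]0%R, s[)
  `|superpos F Uh x - derive1 Uh x|%:E)%E.
have G_add (a s : R) : 0 <= a -> a <= s -> (G a + \int[@lebesgue_measure R]_(x in `]a, s[)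
    `|superpos F Uh x - derive1 Uh x|%:E <= G s)%E.
  move=> a0 as_; apply: le_trans (ge0_integral_superadd _ _ _) _ => //.
    apply/disj_setPS => x /=; rewrite !in_itv/= => -[/andP[_ xa] /andP[ax _]].
    by move: xa; rewrite ltNge (ltW ax).
  apply: ge0_integral_subset => // x /=; rewrite !in_itv/= => -[/andP[-> xa]|/andP[ax ->]].
    by rewrite (lt_le_trans xa).
  by rewrite (le_lt_trans a0 ax).
(* On each open step the reconstruction is the polynomial of that step, so the
   residual is the one of [step_estimate]. *)
have step m : (m < M)%N ->
    recon_piece ip F tn r U m.+1 (tn m.+1) = U (tn m.+1) /\
    forall s, tn m <= s <= tn m.+1 ->
      (`|u s - recon_piece ip F tn r U m.+1 s|%:E <=
        `|u (tn m) - U (tn m)|%:E + \int[@lebesgue_measure R]_(x in `]tn m, s[)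
          `|superpos F Uh x - derive1 Uh x|%:E)%E.
  move=> mM; have m1 : (1 <= m.+1 <= M)%N by [].
  have mI : measurable (`]tn m, tn m.+1[%classic : set (measurableTypeR R)).
    exact: measurable_itv.
  have Ioo := lebesgue_measure_itv_lty (tn m) (tn m.+1).
  have [g1 rep1] := L1_rep_LpX2 mI Ioo (FPiU_L2 m.+1 m1).
  have [g rep] := L1_rep_LpX2 mI Ioo (FU_L2 m.+1 m1).
  have ab := lt_tn m mM.
  have [P XP UP] := U_poly m.+1 m1.
  split.
    exact: (recon_piece_right hX (m := m.+1) ab rep1 rep XP UP (galerkin m.+1 m1)).
  have [S [dS [CS reconS]]] := recon_piece_C1 hX r (m := m.+1) ab rep.
  have UhS s : tn m < s < tn m.+1 -> Uh s = S s.
    move=> /[dup] ms /andP[ms1 ms2]; rewrite -reconS/= ?(ltW ms1) ?(ltW ms2)//.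
    rewrite /Uh /reconstruction; case: pickP => [j js|/(_ (Ordinal mM))/=]; last first.
      by rewrite (ltW ms1) (ltW ms2).
    by rewrite -(partition_inj htn mM (ltn_ord j) ms js).
  have a0 : 0 <= tn m by rewrite -tn0 (partition_le htn)// ltnW.
  have bT : tn m.+1 <= T by rewrite -tnM (partition_le htn).
  move=> s /[dup] ms /andP[ms1 ms2].
  have := step_estimate hX F_orth F_skew hu a0 bT CS UhS mFUh ms1 ms2.
  rewrite -(reconS s ms) -(reconS (tn m)) /= ?lexx ?(ltW ab)//.
  by rewrite (recon_piece_left hX r (m := m.+1) ab rep).
have node m : (m <= M)%N -> (`|u (tn m) - U (tn m)|%:E <= G (tn m))%E.
  elim: m => [|m IH] mM.
    by rewrite tn0 U0; case: hu => -> _; rewrite subrr normr0 /G integral_ge0.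
  have [reconU est] := step m mM.
  have ab := lt_tn m mM.
  rewrite -reconU; apply: le_trans (est _ _) _; first by rewrite lexx ltW.
  apply: le_trans (leeD2r _ (IH (ltnW mM))) _; apply: G_add; last exact: ltW.
  by rewrite -tn0 (partition_le htn)// ltnW.
have error (s : R) : 0 <= s <= T -> (`|u s - Uh s|%:E <= G s)%E.
  move=> sT; rewrite /Uh /reconstruction; case: pickP => [m ms|no]; last first.
    by have [m ms] := partition_cover htn hT sT; have := no m; rewrite ms.
  have [_ est] := step m (ltn_ord m); have /andP[ms1 _] := ms.
  apply: le_trans (est s ms) _.
  apply: le_trans (leeD2r _ (node m (ltnW (ltn_ord m)))) _; apply: G_add => //.
  by rewrite -tn0 (partition_le htn)// ltnW.
rewrite LpX_norm1E -/(G t); apply: LpX_normy_le => [|s]; first exact: integral_ge0.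
rewrite /= in_itv/= => /andP[s0 st].
have sT : 0 <= s <= T by rewrite ltW// (le_trans (ltW st)).
have Gst : (G s <= G t)%E.
  apply: ge0_integral_subset => // x /=; rewrite !in_itv/= => /andP[-> xs].
  exact: lt_trans xs st.
apply: le_trans (leeD2r _ (le_trans (error s sT) Gst)).
rewrite -EFinD lee_fin -(subrK (Uh s) (u s)) -addrA.
by apply: le_trans (ler_normD _ _) _; rewrite subrK lerD2l distrC.
Qed.
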